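(* Let $\widetilde S$ be a proper spacelike surface in $\widetilde{\mathrm{AdS}}$, and let $E(\partial S)$ be the invisible domain of the projection $\partial S\subset \mathrm{Ein}_2$ of its boundary $\partial\widetilde S\subset\widehat{\mathrm{Ein}}_2$. Then $E(\partial S)$ (with the AdS metric) has regular cosmological time.
   Context: Let $E=\mathbb R^4$ with $Q=-u^2-v^2+x_1^2+x_2^2$, $\mathrm{AdS}=\{Q=-1\}$ with the induced Lorentzian metric, identified with $\{[x]\in S(E):Q(x)<0\}$, where $S(E)$ is the space of rays of $E$; its boundary is $\mathrm{Ein}_2=\{[x]:Q(x)=0\}$. Let $\mathbb D^2=\{p\in S^2:p_3>0\}$, $d$ the spherical distance, $O=(0,0,1)$. The map $\overline{\mathbb D}^2\times\mathbb R\to S(E)$, $(p,\theta)\mapsto[(\cos\theta,\sin\theta,p_1,p_2)]$ identifies $\mathbb D^2\times\mathbb R$ with the universal covering $\widetilde{\mathrm{AdS}}$, with metric $\frac{1}{\cos^2 d(p,O)}(ds^2-d\theta^2)$ ($ds^2$ the spherical metric), and $\partial\mathbb D^2\times\mathbb R$ with the infinite cyclic covering $\widehat{\mathrm{Ein}}_2$ of $\mathrm{Ein}_2$; time orientation: $\theta$ increasing. A proper spacelike surface in $\widetilde{\mathrm{AdS}}$ is a connected properly embedded surface without boundary which is locally the graph of a contracting map ($|f(x)-f(y)|<d(x,y)$ for $x\neq y$) from $\mathbb D^2$ to $\mathbb R$; it is then globally the graph of such a map $f:\mathbb D^2\to\mathbb R$, which extends to a $1$-Lipschitz map on $\overline{\mathbb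 D}^2$, and $\partial\widetilde S$ is the graph of the extension on $\partial\mathbb D^2$. The invisible domain is the projection $E(\partial S)$ to $\mathrm{AdS}$ (the projection being injective on it) of $E(\partial\widetilde S)=\{(x,\theta)\in\mathbb D^2\times\mathbb R:\sup_{y\in\partial\mathbb D^2}(f(y)-d(x,y))<\theta<\inf_{y\in\partial\mathbb D^2}(f(y)+d(x,y))\}$. Cosmological time of a time-oriented spacetime $M$: $\tau(x)=\sup L(c)$ over past-oriented causal curves $c$ in $M$ starting at $x$, where $L(c)=\int\sqrt{-\langle c'(t)\mid c'(t)\rangle}\,dt$. $M$ has regular cosmological time if $\tau(x)<\infty$ for every $x\in M$ and, for every past-oriented inextendible causal curve $c:[0,+\infty[\to M$, $\lim_{t\to\infty}\tau(c(t))=0$. *)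

(* Defs.v *)
From HB Require Import structures.
From mathcomp Require Export all_boot all_order all_algebra.
From mathcomp Require Export all_classical all_reals all_analysis.
From mathcomp Require Import ring.
Export Order.TTheory GRing.Theory Num.Theory.
Export numFieldNormedType.Exports.
Set Implicit Arguments.
Unset Strict Implicit.
Unset Printing Implicit Defensive.
Local Open Scope classical_set_scope.
Local Open Scope ring_scope.

(* Coordinates of E = R^4 are (u, v, x1, x2) = (x 0 0, x 0 1, x 0 2, x 0 3);
   those of a point p of S^2 in R^3 are (p 0 0, p 0 1, p 0 2), so that the
   pole O = (0, 0, 1) is the centre of the disc D2. *)

Section AdS.
Context {R : realType}.

Definition Q (x : 'rV[R]_4) : R :=
  - x 0 0 ^+ 2 - x 0 1 ^+ 2 + x 0 2 ^+ 2 + x 0 3 ^+ 2.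

Definition AdS : set 'rV[R]_4 := [set x | Q x = - 1].

Definition dot3 (p q : 'rV[R]_3) : R :=
  p 0 0 * q 0 0 + p 0 1 * q 0 1 + p 0 2 * q 0 2.

Definition sphere : set 'rV[R]_3 := [set p | dot3 p p = 1].

Definition sdist (p q : 'rV[R]_3) : R := acos (dot3 p q).

Definition D2 : set 'rV[R]_3 := [set p | sphere p /\ 0 < p 0 2].
Definition clD2 : set 'rV[R]_3 := [set p | sphere p /\ 0 <= p 0 2].
Definition bdD2 : set 'rV[R]_3 := [set p | sphere p /\ p 0 2 = 0].

(* A representative of the ray associated with (p, theta). *)
Definition ray_rep (z : 'rV[R]_3 * R) : 'rV[R]_4 :=
  \row_(j < 4) [:: cos z.2; sin z.2; z.1 0 0; z.1 0 1]`_j.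

(* The point of AdS on the ray of x, when Q x < 0. *)
Definition ads_of_ray (x : 'rV[R]_4) : 'rV[R]_4 :=
  (Num.sqrt (- Q x))^-1 *: x.

(* The covering map from D2 x R, the universal covering of AdS. *)
Definition proj (z : 'rV[R]_3 * R) : 'rV[R]_4 := ads_of_ray (ray_rep z).

Lemma proj_AdS (z : 'rV[R]_3 * R) : D2 z.1 -> AdS (proj z).
Proof.
case: z => p t [/= sp p2]; rewrite /AdS /proj /ads_of_ray /=.
have QE : Q (ray_rep (p, t)) = - p 0 2 ^+ 2.
  rewrite /Q /ray_rep !mxE /=.
  have := cos2Dsin2 t; move: sp; rewrite /sphere /dot3 /= -!expr2 => sp ct.
  by rewrite -opprD ct -sp !opprD; ring.
set a := Num.sqrt _; have a2 : a ^+ 2 = p 0 2 ^+ 2.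
  by rewrite /a QE opprK sqrtr_sqr real_normK // num_real.
have -> : Q (a^-1 *: ray_rep (p, t)) = a^-1 ^+ 2 * Q (ray_rep (p, t)).
  by rewrite /Q !mxE; ring.
by rewrite QE exprVn a2 mulrN mulVf // expf_neq0 // gt_eqF.
Qed.

Definition contracting (U : set 'rV[R]_3) (f : 'rV[R]_3 -> R) : Prop :=
  forall p q, U p -> U q -> p != q -> `|f p - f q| < sdist p q.

Definition graph_over (U : set 'rV[R]_3) (f : 'rV[R]_3 -> R) :
  set ('rV[R]_3 * R) := [set z | U z.1 /\ z.2 = f z.1].

(* S is nonempty, connected, closed in D2 x R, and each of its points has a
   product neighbourhood in which S is the graph of a contracting map defined
   on a whole open subset of D2; this makes S an embedded surface without
   boundary, and closedness makes the embedding proper. *)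
Definition proper_spacelike_surface (S : set ('rV[R]_3 * R)) : Prop :=
  [/\ S `<=` D2 `*` setT,
      S !=set0,
      connected S,
      closure S `&` (D2 `*` setT) `<=` S
    & forall z, S z -> exists (U : set 'rV[R]_3) (V : set R) f,
        [/\ open U /\ U z.1, open V /\ V z.2, contracting (U `&` D2) f
          & S `&` (U `*` V) = graph_over (U `&` D2) f]].

(* S is globally the graph of the contracting map f over D2, and f is extended
   to a 1-Lipschitz map on the closed disc. The extension is determined by S,
   and the boundary of S is the graph of f over bdD2; the values of f off the
   closed disc are irrelevant. *)
Definition defining_map (S : set ('rV[R]_3 * R)) (f : 'rV[R]_3 -> R) : Prop :=
  [/\ S = graph_over D2 f,
      contracting D2 f
    & forall p q, clD2 p -> clD2 q -> `|f p - f q| <= sdist p q].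

Definition invisible_cover (f : 'rV[R]_3 -> R) : set ('rV[R]_3 * R) :=
  [set z | [/\ D2 z.1,
    sup [set f y - sdist z.1 y | y in bdD2] < z.2
    & z.2 < inf [set f y + sdist z.1 y | y in bdD2]]].

Definition invisible_domain (f : 'rV[R]_3 -> R) : set 'rV[R]_4 :=
  proj @` invisible_cover f.

(* The metric of AdS being induced by Q, a tangent vector w of AdS is causal
   iff w != 0 and Q w <= 0. The last condition says that d theta (w) < 0:
   theta is an argument of u + i v, so u w_v - v w_u = (u^2 + v^2) d theta (w). *)
Definition past_causal_vector (x w : 'rV[R]_4) : Prop :=
  [/\ w != 0, Q w <= 0 & x 0 0 * w 0 1 - x 0 1 * w 0 0 < 0].

Definition parameter_interval (I : set R) : Prop :=
  [/\ is_interval I, I 0 & forall t, I t -> 0 <= t].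

(* Causal curves are locally Lipschitz, with causal derivative almost
   everywhere; M is a subset of AdS, so derivatives are tangent to AdS. *)
Definition past_causal_curve (M : set 'rV[R]_4) (I : set R)
    (c : R -> 'rV[R]_4) : Prop :=
  [/\ parameter_interval I,
      forall t, I t -> M (c t),
      forall b, I b -> [lipschitz c t | t in `[0, b]]
    & {ae lebesgue_measure, forall t, I t ->
        derivable c t 1 /\ past_causal_vector (c t) (derive1 c t)}].

Definition curve_length (I : set R) (c : R -> 'rV[R]_4) : \bar R :=
  (\int[lebesgue_measure]_(t in I) (Num.sqrt (- Q (derive1 c t)))%:E)%E.

Definition cosmological_time (M : set 'rV[R]_4) (x : 'rV[R]_4) : \bar R :=
  ereal_sup [set l | exists I c,
    [/\ past_causal_curve M I c, c 0 = x & l = curve_length I c]].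

Definition inextendible (M : set 'rV[R]_4) (c : R -> 'rV[R]_4) : Prop :=
  ~ exists2 z, M z & c t @[t --> +oo] --> z.

Definition regular_cosmological_time (M : set 'rV[R]_4) : Prop :=
  (forall x, M x -> (cosmological_time M x < +oo)%E) /\
  (forall c, past_causal_curve M `[0, +oo[ c -> inextendible M c ->
     cosmological_time M (c t) @[t --> +oo] --> 0%E).

End AdS.

(* Main.v *)
Require Import Defs.
From mathcomp Require Import ring lra measurable_realfun.
Set Implicit Arguments.
Unset Strict Implicit.
Unset Printing Implicit Defensive.
Local Open Scope classical_set_scope.
Local Open Scope ring_scope.

(* In the linear model, the invisible domain M is the set of x in AdS with
   <x|y> < 0 for all y in the boundary curve, a curve of null vectors.  If N is
   a vector field along AdS whose tangential part is timelike and future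
   directed and is the gradient of -G up to a positive factor, with
   |grad G|^2 <= -(1 - G^2), the reverse Cauchy-Schwarz inequality shows that
   arccos G grows at least at unit rate along past causal curves, so that their
   length is at most pi - arccos G(x).

   Finiteness: take G = -<z|.>, where z lies slightly in the future of x; it
   stays above -1 because <x|x'> < 1 for x, x' in M.  These functions are also
   monotone along a past causal curve c : [0, +oo[ -> M, and such z span E, so
   c converges in AdS.  If the limit is not in M, then it is orthogonal to some
   point y1 of the boundary curve; let y2 be the point above the antipode of y1
   in the circle, so that <y1|y2> < 0.  The function
   G = -4 <y1|.><y2|.> / <y1|y2> - 1 tends to -1 along c, hence the bound
   pi - arccos G on the cosmological time tends to 0. *)

(** * Linear algebra of the quadratic form of signature (2,2) *)

Section LinearAlgebra.
Context {R : realType}.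
Implicit Types (x y z w v N : 'rV[R]_4).

Definition dotQ x y : R :=
  - (x 0 0 * y 0 0) - x 0 1 * y 0 1 + x 0 2 * y 0 2 + x 0 3 * y 0 3.

(** A positive multiple of [d theta] at a point of AdS, so its sign tells future from past for
    timelike vectors. *)
Definition om x w : R := x 0 0 * w 0 1 - x 0 1 * w 0 0.

Lemma dotQC x y : dotQ x y = dotQ y x.
Proof. by rewrite /dotQ; ring. Qed.

Lemma dotQxx x : dotQ x x = Q x.
Proof. by rewrite /dotQ /Q; ring. Qed.

Lemma dotQD x y z : dotQ x (y + z) = dotQ x y + dotQ x z.
Proof. by rewrite /dotQ !mxE; ring. Qed.

Lemma dotQZ x a y : dotQ x (a *: y) = a * dotQ x y.
Proof. by rewrite /dotQ !mxE; ring. Qed.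

Lemma dotQDl x y z : dotQ (y + z) x = dotQ y x + dotQ z x.
Proof. by rewrite !(dotQC _ x) dotQD. Qed.

Lemma dotQZl x a y : dotQ (a *: y) x = a * dotQ y x.
Proof. by rewrite !(dotQC _ x) dotQZ. Qed.

Lemma QD x y : Q (x + y) = Q x + 2 * dotQ x y + Q y.
Proof. by rewrite /Q /dotQ !mxE; ring. Qed.

Lemma QZ a x : Q (a *: x) = a ^+ 2 * Q x.
Proof. by rewrite /Q !mxE; ring. Qed.

Lemma omD x y z : om x (y + z) = om x y + om x z.
Proof. by rewrite /om !mxE; ring. Qed.

Lemma omZ x a y : om x (a *: y) = a * om x y.
Proof. by rewrite /om !mxE; ring. Qed.

Lemma omxx x : om x x = 0.
Proof. by rewrite /om; ring. Qed.

(** The slices of constant [theta] are spacelike. With x = (a, b, c, d) and v = (p, q, r, s),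
    Lagrange's identity in the negative plane turns the two conditions into (a^2+b^2)(p^2+q^2) =
    (cr+ds)^2. Cauchy-Schwarz in the positive plane bounds this by (c^2+d^2)(r^2+s^2), and c^2+d^2 =
    a^2+b^2-1. *)
Lemma orth_spacelike x v : Q x = - 1 -> dotQ x v = 0 -> om x v = 0 -> 0 <= Q v.
Proof.
rewrite /Q /dotQ /om => Qx dxv oxv.
set a := x 0 0 in Qx dxv oxv; set b := x 0 1 in Qx dxv oxv.
set c := x 0 2 in Qx dxv; set d := x 0 3 in Qx dxv.
set p := v 0 0 in dxv oxv *; set q := v 0 1 in dxv oxv *.
set r := v 0 2 in dxv *; set s := v 0 3 in dxv *.
have rE : a ^+ 2 + b ^+ 2 = 1 + c ^+ 2 + d ^+ 2 by lra.
have r0 : 0 < a ^+ 2 + b ^+ 2.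
  by rewrite rE; have := sqr_ge0 c; have := sqr_ge0 d; lra.
have e1 : (a ^+ 2 + b ^+ 2) * (p ^+ 2 + q ^+ 2) = (c * r + d * s) ^+ 2.
  have -> : c * r + d * s = a * p + b * q by lra.
  transitivity ((a * p + b * q) ^+ 2 + (a * q - b * p) ^+ 2); first by ring.
  by rewrite oxv; ring.
have e2 : (c ^+ 2 + d ^+ 2) * (r ^+ 2 + s ^+ 2) =
          (c * r + d * s) ^+ 2 + (c * s - d * r) ^+ 2 by ring.
have := sqr_ge0 (c * s - d * r) => e3.
have e4 : 0 <= r ^+ 2 + s ^+ 2 by rewrite addr_ge0 ?sqr_ge0.
suff : 0 <= (a ^+ 2 + b ^+ 2) * (- p ^+ 2 - q ^+ 2 + r ^+ 2 + s ^+ 2).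
  by rewrite pmulr_rge0.
have -> : (a ^+ 2 + b ^+ 2) * (- p ^+ 2 - q ^+ 2 + r ^+ 2 + s ^+ 2) =
  (a ^+ 2 + b ^+ 2) * (r ^+ 2 + s ^+ 2) -
  (a ^+ 2 + b ^+ 2) * (p ^+ 2 + q ^+ 2) by ring.
by rewrite e1 rE -addrA mulrDl mul1r e2; lra.
Qed.

(** The tangential part of [N] at [x] is [N + dotQ x N *: x]; its square is the quantity assumed
    negative, and [om x] takes the same value on it as on [N]. *)
Lemma om_neq0 x N : Q x = - 1 -> Q N + dotQ x N ^+ 2 < 0 -> om x N != 0.
Proof.
move=> Qx QN; apply/eqP => oxN.
have := @orth_spacelike x (N + dotQ x N *: x) Qx.
rewrite dotQD dotQZ dotQxx Qx omD omZ omxx oxN QD QZ dotQZ Qx (dotQC N x).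
by move=> /(_ ltac:(ring) ltac:(ring)); lra.
Qed.

(** The combination of [w] and of the tangential part of [N] with positive coefficients [om x N] and
    [- om x w] is killed by [om x], hence spacelike. Expanding its square gives b^2 A + a^2 B <= 2ab
    P, and the inequality of arithmetic and geometric means turns this into AB <= P^2. *)
Lemma reverse_cauchy_schwarz x w N :
  Q x = - 1 -> dotQ x w = 0 -> Q w <= 0 -> om x w < 0 ->
  Q N + dotQ x N ^+ 2 < 0 -> 0 < om x N ->
  0 <= dotQ N w /\ - Q w * - (Q N + dotQ x N ^+ 2) <= dotQ N w ^+ 2.
Proof.
move=> Qx dxw Qw oxw QN oxN.
have := @orth_spacelike x (om x N *: w + (- om x w) *: (N + dotQ x N *: x)) Qx.
rewrite dotQD !dotQZ dotQD dotQZ dotQxx Qx omD !omZ omD omZ omxx dxw.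
rewrite QD !QZ dotQZl dotQZ dotQD dotQZ QD QZ dotQZ (dotQC w x) dxw Qx.
rewrite (dotQC N x) (dotQC w N) => /(_ ltac:(ring) ltac:(ring)).
set P := dotQ N w; set A := - Q w; set B := - (Q N + _).
set a := - om x w; set b := om x N => H.
have a0 : 0 < a by rewrite /a; lra.
have b0 : 0 < b by [].
have A0 : 0 <= A by rewrite /A; lra.
have B0 : 0 < B by rewrite /B; lra.
have ab0 : 0 < a * b by rewrite mulr_gt0.
have H1 : b ^+ 2 * A + a ^+ 2 * B <= 2 * (a * b) * P.
  by rewrite -subr_ge0 (le_trans H) // le_eqVlt; apply/orP; left; apply/eqP;
    rewrite /A /B /P; ring.
have S0 : 0 <= b ^+ 2 * A + a ^+ 2 * B.
  by rewrite addr_ge0 // mulr_ge0 ?sqr_ge0 // ltW.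
have P0 : 0 <= P.
  have : 0 <= 2 * (a * b) * P by lra.
  by rewrite pmulr_rge0 // mulr_gt0.
split => //.
have H2 : (b ^+ 2 * A + a ^+ 2 * B) ^+ 2 <= (2 * (a * b) * P) ^+ 2.
  by rewrite ler_sqr ?nnegrE //; lra.
have H3 : 4 * (a * b) ^+ 2 * (A * B) <= (b ^+ 2 * A + a ^+ 2 * B) ^+ 2.
  by rewrite -subr_ge0; have := sqr_ge0 (b ^+ 2 * A - a ^+ 2 * B); lra.
have c0 : 0 < 4 * (a * b) ^+ 2 by rewrite mulr_gt0 // exprn_gt0.
rewrite -(ler_pM2l c0); apply: (le_trans H3); apply: (le_trans H2).
by rewrite le_eqVlt; apply/orP; left; apply/eqP; ring.
Qed.

End LinearAlgebra.

(** * Upper bounds for integrals of functions not known to be measurable *)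

Section LowerIntegral.
Context (d : measure_display) (T : measurableType d) (R : realType).
Variable mu : {measure set T -> \bar R}.
Implicit Types (D : set T) (f g : T -> \bar R) (C : \bar R).
Import HBNNSimple.

(** The integral of a nonnegative function is a supremum over the simple functions below it, so
    theorems on measurable functions can be applied to these. This serves the length integrand,
    whose measurability is not established. *)
Lemma integral_le_nnsfun D f C :
  measurable D -> (forall x, D x -> 0 <= f x)%E ->
  (forall h : {nnsfun T >-> R}, (forall x, D x -> (h x)%:E <= f x)%E ->
     \int[mu]_(x in D) (h x)%:E <= C)%E ->
  (\int[mu]_(x in D) f x <= C)%E.
Proof.
move=> mD f0 H; rewrite ge0_integralE//; apply: ge_ereal_sup => _ [h hf <-].
(* Off [D] the restriction of [f] is 0, which forces the nonnegative [h] to vanish there. *)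
have hD : h \_ D = h.
  apply/funext => x; rewrite patchE; case: ifPn => // xD.
  have := hf x; rewrite patchE (negbTE xD) lee_fin => hx.
  by apply/eqP; rewrite eq_le hx /= fun_ge0.
rewrite -hD -integral_nnsfun//; apply: H => x Dx.
by have := hf x; rewrite patchE mem_set.
Qed.

Lemma ae_le_integral_majorant D f g :
  measurable D -> (forall x, D x -> 0 <= f x)%E ->
  (forall x, D x -> 0 <= g x)%E -> measurable_fun D g ->
  {ae mu, forall x, D x -> (f x <= g x)%E} ->
  (\int[mu]_(x in D) f x <= \int[mu]_(x in D) g x)%E.
Proof.
move=> mD f0 g0 mg fg; apply: integral_le_nnsfun => // h hf.
apply: ae_ge0_le_integral => //.
- by move=> x _; rewrite lee_fin fun_ge0.
- exact/measurable_EFinP/measurable_funTS.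
- by apply: filterS fg => x fgx Dx; exact: le_trans (hf _ Dx) (fgx Dx).
Qed.

(** Continuity of the integral along an increasing union, applied to each simple function below
    [f]. *)
Lemma integral_le_exhaustion D (F : (set T)^nat) f C : measurable D ->
  (forall x, D x -> 0 <= f x)%E -> nondecreasing_seq F ->
  (forall n, measurable (F n)) -> \bigcup_n F n = D ->
  (forall n, \int[mu]_(x in F n) f x <= C)%E -> (\int[mu]_(x in D) f x <= C)%E.
Proof.
move=> mD f0 ndF mF FD FC; apply: integral_le_nnsfun => // h hf.
have FsubD n : F n `<=` D by rewrite -FD; exact: bigcup_sup.
have mh A : measurable_fun A (EFin \o h).
  exact/measurable_EFinP/measurable_funTS.
have h0 (n : nat) x : F n x -> (0 <= (EFin \o h) x)%E.
  by rewrite lee_fin fun_ge0.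
rewrite -FD.
have cv := @ge0_nondecreasing_set_cvg_integral _ _ _ F _ mu ndF mF
  (fun n => mh (F n)) h0.
rewrite -(cvg_lim _ cv)//; apply: lime_le.
  by apply/cvg_ex; eexists; exact: cv.
apply: nearW => n; apply: le_trans (FC n).
rewrite (ge0_integralE mu (h0 n)).
rewrite (ge0_integralE mu (fun x Fx => f0 x (FsubD n x Fx))).
apply: ereal_sup_le => _ [k kh <-]; exists k => // x; apply: le_trans (kh x) _.
rewrite !patchE; case: ifPn => //; rewrite inE => /FsubD; exact: hf.
Qed.

End LowerIntegral.

(** * The integral of the derivative of a monotone function *)

Section MonotoneDerivative.
Context {R : realType}.
Notation mu := (@lebesgue_measure R).
Implicit Types (B l : R -> R) (a b t : R).

Lemma continuous_primitive B a : continuous B ->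
  exists P : R -> R, forall t, a < t -> is_derive t 1 P (B t).
Proof.
move=> cB; exists (fun x => (\int[mu]_(t in `[a, x]) B t)%R) => t at_.
have tu : t < t + 1 by rewrite ltrDl.
have iB : mu.-integrable `[a, t + 1] (EFin \o B).
  apply: continuous_compact_integrable; first exact: segment_compact.
  exact: continuous_subspaceT.
have [dP P'] := continuous_FTC1_closed tu iB at_ (cB t).
by apply: DeriveDef; [exact: dP|rewrite -derive1E].
Qed.

(** The difference quotient of [B] is the derivative of that of a primitive [P] of [B]. The integral
    is therefore a difference of two quotients of [P], which the mean value theorem compares with
    values of the monotone [B]. *)
Lemma integral_difference_quotient B a b (n : nat) :
  continuous B -> {homo B : x y / x <= y} -> a < b ->
  (\int[mu]_(t in `[a, b])
     (n.+1%:R * (B (t + n.+1%:R^-1) - B t))%:E <=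
   (B (b + n.+1%:R^-1) - B a)%:E)%E.
Proof.
move=> cB ndB ab; set h : R := n.+1%:R^-1.
have h0 : 0 < h by rewrite invr_gt0.
(* The primitive starts at [a - 1] in order to be differentiable at [a] itself. *)
have [P dP] := continuous_primitive (a - 1) cB.
have a1 : a - 1 < a by rewrite ltrBlDr ltrDl.
have P_diff x : a <= x -> h * B x <= P (x + h) - P x <= h * B (x + h).
  move=> ax; have [|||c] := @MVT R P B x (x + h).
  - by rewrite ltrDl.
  - move=> y; rewrite in_itv/= => /andP[xy _]; apply: dP.
    by apply: lt_le_trans (ltW xy); exact: lt_le_trans ax.
  - apply: derivable_within_continuous => y; rewrite in_itv/= => /andP[xy _].
    by have [] := dP y (lt_le_trans a1 (le_trans ax xy)).
  - rewrite in_itv/= => /andP[xc cx] ->.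
    rewrite (addrC x h) addrK (mulrC _ h) !ler_pM2l//.
    by rewrite !ndB// ltW// addrC.
pose F := (fun t => n.+1%:R * (P (t + h) - P t)).
have dF t : a <= t -> is_derive t 1 F (n.+1%:R * (B (t + h) - B t)).
  move=> at_.
  have d1 := dP t (lt_le_trans a1 at_).
  have d2 : is_derive (t + h) 1 P (B (t + h)).
    by apply: dP; apply: (lt_le_trans a1); rewrite (le_trans at_)// lerDl ltW.
  have d3 : is_derive t 1 (fun t => t + h) 1.
    by rewrite -[X in is_derive _ _ _ X](addr0 1); apply: is_deriveD.
  have d4 : is_derive t 1 (P \o (fun t => t + h)) (B (t + h)).
    by rewrite -[X in is_derive _ _ _ X]mulr1; exact: is_derive1_comp.
  have := is_deriveZ n.+1%:R (is_deriveB d4 d1).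
  by [].
have cF t : a <= t -> {for t, continuous F}.
  by move=> /dF[dFt _]; apply: differentiable_continuous; exact/derivable1_diffP.
rewrite (@continuous_FTC2 R _ F)//.
- rewrite -EFinB lee_fin /F -mulrBr.
  have /andP[_ Pb] := P_diff b (ltW ab); have /andP[Pa _] := P_diff a (lexx _).
  rewrite -(ler_pM2l h0) mulrA mulVf ?mul1r; last by rewrite pnatr_eq0.
  by rewrite mulrBr lerB.
- apply: continuous_subspaceT => t.
  apply: cvgM; first exact: cvg_cst.
  apply: cvgB; last exact: cB.
  apply: continuous_comp; last exact: cB.
  by apply: cvgD; [exact: cvg_id|exact: cvg_cst].
- split.
  + by move=> t; rewrite in_itv/= => /andP[/ltW/dF[]].
  + by apply: cvg_at_right_filter; apply: cF.
  + by apply: cvg_at_left_filter; apply: cF; exact: ltW.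
- move=> t; rewrite in_itv/= => /andP[/ltW/dF[_ <-] _].
  by rewrite derive1E.
Qed.

Lemma ae_neq a : {ae mu, forall t, t != a}.
Proof.
exists [set a]; split; [exact: measurable_set1|exact: lebesgue_measure_set1|].
by move=> t /=; apply: contra_notP => /eqP.
Qed.

Lemma derivable_difference_quotient B t : derivable B t 1 ->
  (n.+1%:R * (B (t + n.+1%:R^-1) - B t)) @[n --> \oo] --> derive1 B t.
Proof.
move=> dB; have cvB : h^-1 *: (B (h + t) - B t) @[h --> 0^'] --> derive1 B t.
  rewrite derive1E; move: dB; rewrite /derivable /derive.
  by under eq_fun do rewrite [_ *: 1]mulr1.
have /cvg_at_rightP/(_ harmonic) :
    h^-1 *: (B (h + t) - B t) @[h --> 0^'+] --> derive1 B t.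
  exact: cvg_dnbhs_at_right cvB.
move=> /(_ (conj (@harmonic_gt0 R) cvg_harmonic)).
by under eq_fun do rewrite /= invrK (addrC _ t).
Qed.

(** Lebesgue's inequality for monotone functions, which requires no absolute continuity: Fatou's
    lemma is applied to the difference quotients at scale 1/(n+1), whose integrals have just been
    bounded. *)
Lemma integral_le_monotone_derivative B l a b : a <= b ->
  continuous B -> {homo B : x y / x <= y} -> (forall t, 0 <= l t) ->
  {ae mu, forall t, a < t < b -> derivable B t 1 /\ l t <= derive1 B t} ->
  (\int[mu]_(t in `[a, b]) (l t)%:E <= (B b - B a)%:E)%E.
Proof.
rewrite le_eqVlt => /predU1P[<- _ _ _ _|ab cB ndB l0 dB].
  by rewrite set_itv1 integral_set1 subrr.
pose u (n : nat) t := (n.+1%:R * (B (t + n.+1%:R^-1) - B t))%:E.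
have mu_ n : measurable_fun `[a, b] (u n).
  apply/measurable_EFinP; apply: measurable_funTS.
  apply: continuous_measurable_fun => t.
  apply: cvgM; first exact: cvg_cst.
  apply: cvgB; last exact: cB.
  apply: continuous_comp; last exact: cB.
  by apply: cvgD; [exact: cvg_id|exact: cvg_cst].
have u0 n t : t \in `[a, b] -> (0 <= u n t)%E.
  by rewrite lee_fin mulr_ge0// subr_ge0 ndB// lerDl invr_ge0.
have liminf_ge0 t : t \in `[a, b] -> (0 <= limn_einf (u ^~ t))%E.
  move=> abt; rewrite limn_einf_lim; apply: lime_ge; first exact: is_cvg_einfs.
  by apply: nearW => n; apply: le_ereal_inf_tmp => _ [k /= _ <-]; exact: u0.
apply: (@le_trans _ _ (\int[mu]_(t in `[a, b]) limn_einf (u ^~ t))%E).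
  apply: ae_le_integral_majorant => //.
  - by move=> t _; rewrite lee_fin.
  - have -> : (fun t => limn_einf (u ^~ t)) =
        (fun t => - limn_esup (fun n => - u n t))%E by [].
    apply: (measurableT_comp (@oppe_measurable R setT)).
    apply: measurable_fun_limn_esup => n.
    exact: (measurableT_comp (@oppe_measurable R setT) (mu_ n)).
  - have FF : Filter (nbhs (almost_everywhere mu)).
      exact: ae_filter_ringOfSetsType.
    apply: filterS3 (ae_neq a) (ae_neq b) dB => t ta tb dBt.
    rewrite /= in_itv/= => /andP[at_ tb'].
    have /dBt[dt lt] : a < t < b by rewrite !lt_neqAle at_ tb' eq_sym ta tb.
    rewrite (@cvg_limn_einf_sup _ _ (derive1 B t)%:E) ?lee_fin//.
    by apply: cvg_EFin; [exact: nearW|exact: derivable_difference_quotient].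
apply: (le_trans (fatou _ _ _ _)) => //.
have cvB : ((B (b + n.+1%:R^-1) - B a)%:E @[n --> \oo] --> (B b - B a)%:E)%E.
  apply: cvg_EFin; first exact: nearW.
  apply: cvgB; last exact: cvg_cst.
  apply: continuous_cvg; first exact: cB.
  rewrite -[X in _ --> X]addr0; apply: cvgD; [exact: cvg_cst|exact: cvg_harmonic].
rewrite -(cvg_limn_einf_sup cvB).
rewrite !limn_einf_lim; apply: lee_lim; [exact: is_cvg_einfs|exact: is_cvg_einfs|].
apply: nearW => n; apply: le_ereal_inf_tmp => _ [k /= nk <-].
apply: (@le_trans _ _ (\int[mu]_(t in `[a, b]) u k t)%E).
  by apply: ereal_inf_lbound; exists k.
exact: integral_difference_quotient.
Qed.

End MonotoneDerivative.

(** * Monotonicity and Lipschitz bounds for cosine and arccosine *)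

Section Trigonometry.
Context {R : realType}.
Implicit Types (a b t x y : R).

Lemma ler_cos_pi a b : 0 <= a -> a <= b -> b <= pi -> cos b <= cos a :> R.
Proof.
move=> a0 ab bp; rewrite leNgt ltr_cos ?in_itv/= ?a0 ?(le_trans ab)//.
  by rewrite -leNgt.
by rewrite (le_trans a0).
Qed.

Lemma ltr_cos_pi a b : 0 <= a -> a < b -> b <= pi -> cos b < cos a :> R.
Proof.
move=> a0 ab bp; rewrite ltr_cos ?in_itv/= ?a0 ?(le_trans (ltW ab))//.
by rewrite bp (le_trans a0 (ltW ab)).
Qed.

Lemma acos_nonincreasing x y : -1 <= x -> x <= y -> y <= 1 ->
  acos y <= acos x :> R.
Proof.
move=> x1 xy y1.
have [x0p cx] := @acos_def R x (introT andP (conj x1 (le_trans xy y1))).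
have [y0p cy] := @acos_def R y (introT andP (conj (le_trans x1 xy) y1)).
by rewrite leNgt -ltr_cos ?in_itv//= cx cy -leNgt.
Qed.

Lemma acos_cos_le t : acos (cos t) <= `|t|.
Proof.
rewrite -cos_norm; have [tp|/ltW tp] := leP `|t| pi.
  by rewrite cosK// in_itv/= normr_ge0.
by apply: le_trans tp; rewrite acos_lepi// cos_geN1 cos_le1.
Qed.

Lemma cos_sub_le a b : a <= b -> cos a - cos b <= b - a :> R.
Proof.
move=> ab; have [|c _ cE] := MVT_segment ab (fun x _ => is_derive_cos x).
  by apply: continuous_subspaceT; exact: continuous_cos.
by rewrite -opprB cE mulNr opprK ler_piMl ?subr_ge0// (le_trans (ler_norm _))// sin_max.
Qed.

End Trigonometry.

(** * Functions of one variable whose arccosine grows at least at a given rate *)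

Section TimeFunction.
Context {R : realType}.
Notation mu := (@lebesgue_measure R).
Implicit Types (g om m l : R -> R) (K a b s t : R).

Lemma klipschitz_continuous (V : normedModType R) (g : R -> V) K :
  (forall s t, `|g s - g t| <= K * `|s - t|) -> continuous g.
Proof.
move=> gK t; have K0 : 0 <= K.
  by have := gK 1 0; rewrite subr0 normr1 mulr1; apply: le_trans.
have K1 : 0 < K + 1 by rewrite ltr_wpDl.
apply/cvgrPdist_lt => e e0; near=> s.
apply: le_lt_trans (gK t s) _.
have : `|t - s| < e / (K + 1).
  by near: s; apply: (nbhsx_ballx t (e / (K + 1))); rewrite divr_gt0.
rewrite ltr_pdivlMr// => ts; apply: le_lt_trans ts.
by rewrite mulrC ler_wpM2l// lerDl.
Unshelve. all: by end_near. Qed.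

(** The function K t - g(t) is nondecreasing, with derivative at least K almost everywhere; its
    increment over [a, b] is thus at least K (b - a). *)
Lemma lipschitz_nonincreasing g K a b : a <= b ->
  (forall s t, `|g s - g t| <= K * `|s - t|) ->
  {ae mu, forall t, a < t < b -> derivable g t 1 /\ derive1 g t <= 0} ->
  g b <= g a.
Proof.
move=> ab gK dg; have K0 : 0 <= K.
  by have := gK 1 0; rewrite subr0 normr1 mulr1; apply: le_trans.
have cg := klipschitz_continuous gK.
pose B t := K * t - g t.
suff : (\int[mu]_(t in `[a, b]) K%:E <= (B b - B a)%:E)%E.
  rewrite integral_cst//= lebesgue_measure_itv/= lte_fin.
  have -> : (if a < b then (b%:E - a%:E)%E else 0%E) = (b - a)%:E.
    by move: ab; rewrite le_eqVlt => /predU1P[->|->]; rewrite ?ltxx ?subrr.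
  by rewrite -EFinM lee_fin /B; lra.
apply: integral_le_monotone_derivative => //.
- move=> t; apply: cvgB; last exact: cg.
  by apply: cvgM; [exact: cvg_cst|exact: cvg_id].
- move=> s t st; rewrite /B.
  by have := gK t s; rewrite (ger0_norm (_ : 0 <= t - s)) ?subr_ge0// ler_norml; lra.
- have FF : Filter (nbhs (almost_everywhere mu)).
    exact: ae_filter_ringOfSetsType.
  apply: filterS dg => t dgt /dgt[dgt1 dgt2].
  have dB : is_derive t 1 B (K - derive1 g t).
    have d1 : is_derive t 1 (fun t : R => K * t) K.
      by rewrite -[X in is_derive _ _ _ X]mulr1; exact: is_deriveZ.
    by apply: is_deriveB; apply: DeriveDef => //; rewrite derive1E.
  split; first by case: dB.
  by rewrite derive1E (@derive_val _ _ _ _ _ _ _ dB); lra.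
Qed.

Lemma continuous_first_exit m a b : a <= b -> continuous m ->
  0 < m a -> m b <= 0 ->
  exists c, [/\ a <= c <= b, m c = 0 & forall s, a <= s < c -> 0 < m s].
Proof.
move=> ab cm ma mb; pose A := `[a, b] `&` m @^-1` [set y | y <= 0].
have cA : compact A.
  apply: compact_closedI; first exact: segment_compact.
  by apply: preimage_closed => [x _|]; [exact: cm|exact: closed_le].
have A0 : A !=set0 by exists b; split => //=; rewrite in_itv/= ab lexx.
have [c cA' cmin] := compact_EVT_min A0 cA (continuous_subspaceT (fun x => cvg_id)).
move: cA'; rewrite inE => -[]; rewrite /= in_itv/= => /andP[ac cb] mc.
have pos s : a <= s < c -> 0 < m s.
  move=> /andP[as_ sc]; rewrite ltNge; apply/negP => ms.
  have : c <= s.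
    by apply: cmin; rewrite inE; split => //=; rewrite in_itv/= as_ (le_trans _ cb)// ltW.
  by rewrite leNgt sc.
exists c; split => //; first by rewrite ac.
apply/eqP; rewrite eq_le mc /=.
have [||s] := @IVT _ m a c 0 ac.
- exact: continuous_subspaceT.
- by rewrite ge_min le_max mc (ltW ma) orbT.
rewrite in_itv/= => /andP[as_ sc] ms; move: sc; rewrite le_eqVlt => /predU1P[<-|sc].
  by rewrite ms.
by have := pos s; rewrite as_ sc ms ltxx => /(_ isT).
Qed.

(** The differential inequality is only assumed where g < 1 and om > 0, so these two conditions are
    first propagated from [a] to [b]. Then [acos \o g] is nondecreasing with derivative at least
    [l], and its increment is at most pi - acos (g a). *)
Lemma time_function_length g om l K a b : a <= b ->
  (forall s t, `|g s - g t| <= K * `|s - t|) -> continuous om ->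
  (forall t, a <= t <= b -> -1 < g t) -> g a < 1 -> 0 < om a ->
  (forall t, a <= t <= b -> g t < 1 -> om t != 0) -> (forall t, 0 <= l t) ->
  {ae mu, forall t, a < t < b -> g t < 1 -> 0 < om t ->
     [/\ derivable g t 1, derive1 g t <= 0
       & (1 - g t ^+ 2) * l t ^+ 2 <= derive1 g t ^+ 2]} ->
  (forall s t, a <= s -> s <= t -> t <= b -> g t <= g s) /\
  (\int[mu]_(t in `[a, b]) (l t)%:E <= (pi - acos (g a))%:E)%E.
Proof.
move=> ab gK com gN1 ga1 oma omN0 l0 dg.
have FF : Filter (nbhs (almost_everywhere mu)).
  exact: ae_filter_ringOfSetsType.
have cg := klipschitz_continuous gK.
have mon s t : a <= s -> s <= t -> t <= b ->
    (forall r, a <= r < t -> 0 < Num.min (om r) (1 - g r)) -> g t <= g s.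
  move=> as_ st tb inside; apply: (lipschitz_nonincreasing st gK).
  apply: filterS dg => r dgr /andP[sr rt].
  have := inside r; rewrite rt (le_trans as_ (ltW sr)) => /(_ isT).
  rewrite lt_min subr_gt0 => /andP[omr gr].
  by case: (dgr _ gr omr) => //; rewrite (le_lt_trans as_ sr) (lt_le_trans rt tb).
pose m t := Num.min (om t) (1 - g t).
have cm : continuous m.
  move=> t; apply: (@continuous_min _ _ om (fun t => 1 - g t)); first exact: com.
  by apply: cvgB; [exact: cvg_cst|exact: cg].
(* At a first zero c of [m], monotonicity on [a, c] gives g(c) <= g(a) < 1. So [om] would have to
   vanish at c, which [omN0] excludes. *)
have inside t : a <= t <= b -> 0 < m t.
  move=> /andP[at_ tb]; rewrite ltNge; apply/negP => mt.
  have [|c [/andP[ac ct] mc pos]] := continuous_first_exit at_ cm _ mt.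
    by rewrite /m lt_min oma subr_gt0.
  have cb := le_trans ct tb.
  have gc : g c < 1 by rewrite (le_lt_trans _ ga1)// mon.
  have := omN0 c; rewrite ac cb => /(_ isT gc).
  move: mc; rewrite /m /Num.min; case: ifPn => [_ ->|_]; first by rewrite eqxx.
  by move=> /eqP; rewrite subr_eq0 => /eqP g1; rewrite -g1 ltxx in gc.
have {}mon s t : a <= s -> s <= t -> t <= b -> g t <= g s.
  move=> as_ st tb; apply: mon => // r /andP[ar rt]; apply: inside.
  by rewrite ar ltW// (lt_le_trans rt).
split; first exact: mon.
(* Clamping the argument to [a, b] makes the composite with [acos] continuous and monotone on the
   whole line. *)
pose cl t := Num.max a (Num.min t b).
have cl_in t : a <= cl t <= b.
  rewrite /cl le_max lexx /= ge_max ab ge_min lexx orbT//.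
have cl_id t : a <= t <= b -> cl t = t.
  by move=> /andP[at_ tb]; rewrite /cl (min_idPl tb) (max_idPr at_).
have cl_homo s t : s <= t -> cl s <= cl t.
  by move=> st; rewrite /cl ge_max !le_max lexx /= le_min !ge_min lexx st !orbT.
have ccl : continuous cl.
  move=> t; apply: (@continuous_max _ _ (cst a) (id \min cst b)).
    exact: cvg_cst.
  by apply: (@continuous_min _ _ id (cst b)); [exact: cvg_id|exact: cvg_cst].
have gcl t : -1 < g (cl t) < 1.
  have /andP[h1 h2] := cl_in t; rewrite gN1 ?h1//=.
  by rewrite (le_lt_trans _ ga1)// mon.
pose B := acos \o (g \o cl).
have Bab : B b - B a <= pi - acos (g a).
  have /andP[/ltW b1 /ltW b2] := gcl b.
  by rewrite /B /= (cl_id a) ?lexx// lerB// acos_lepi// b1.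
apply: (@le_trans _ _ (B b - B a)%:E); last by rewrite lee_fin.
apply: integral_le_monotone_derivative => //.
- move=> t; apply: continuous_comp; last exact/continuous_acos/gcl.
  by apply: continuous_comp; [exact: ccl|exact: cg].
- move=> s t st; apply: acos_nonincreasing.
  + by have /andP[/ltW] := gcl t.
  + have /andP[? _] := cl_in s; have /andP[_ ?] := cl_in t.
    by apply: mon => //; exact: cl_homo.
  + by have /andP[_ /ltW] := gcl s.
- apply: filterS dg => t dgt /andP[at_ tb].
  have tab : a <= t <= b by rewrite !ltW.
  have := inside t tab; rewrite lt_min subr_gt0 => /andP[omt gt1].
  have [|dgt1 dgt2 dgt3] := dgt _ gt1 omt; first by rewrite at_.
  have gt' : -1 < g t < 1 by rewrite gN1.
  have near_cl : \near t, (acos \o g) t = B t.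
    have /near_in_itvoo nab : t \in `]a, b[ by rewrite in_itv/= at_.
    near=> s; have : s \in `]a, b[ by near: s.
    by rewrite in_itv/= => /andP[/ltW as_ /ltW sb]; rewrite /B /= cl_id// as_.
  have dA : is_derive t 1 (acos \o g)
      (- (Num.sqrt (1 - g t ^+ 2))^-1 * derive1 g t).
    have d1 : is_derive t 1 g (derive1 g t).
      by apply: DeriveDef => //; rewrite derive1E.
    have d2 := is_derive1_acos gt'.
    exact: is_derive1_comp.
  have dB : derivable B t 1.
    by apply: near_eq_derivable near_cl _; case: dA.
  split => //; rewrite derive1E -(near_eq_derive _ near_cl).
  rewrite (@derive_val _ _ _ _ _ _ _ dA) mulNr -mulrN mulrC.
  have r0 : 0 < 1 - g t ^+ 2 by move: gt' => /andP[? ?]; nra.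
  rewrite ler_pdivlMr ?sqrtr_gt0//.
  rewrite -ler_sqr ?nnegrE ?mulr_ge0 ?sqrtr_ge0 ?oppr_ge0//.
  rewrite exprMn sqr_sqrtr ?(ltW r0)// sqrrN.
  by rewrite (mulrC (l t ^+ 2)).
Unshelve. all: by end_near. Qed.

End TimeFunction.

(** * Past causal curves and time potentials along them *)

Section Curves.
Context {R : realType}.
Notation mu := (@lebesgue_measure R).
Notation E := 'rV[R]_4.
Implicit Types (x y z w : E) (c : R -> E) (I : set R) (M : set E).
Implicit Types (G : E -> R) (N : E -> E) (a b s t k K D : R).

Lemma coord_le_norm x i : `|x 0 i| <= `|x|.
Proof.
rewrite [in leRHS]/Num.norm/= mx_normrE.
exact: (le_bigmax _ (fun ij => `|x ij.1 ij.2|) (0, i)).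
Qed.

Lemma is_derive_coord c t i : derivable c t 1 ->
  is_derive t 1 (fun s => c s 0 i) (derive1 c t 0 i).
Proof.
move=> dc; apply: DeriveDef; first by move/derivable_mxP : dc; exact.
by rewrite derive1E derive_mx// mxE.
Qed.

Lemma is_derive_dotQ z c t : derivable c t 1 ->
  is_derive t 1 (fun s => dotQ z (c s)) (dotQ z (derive1 c t)).
Proof.
move=> dc; have D i := is_deriveZ (z 0 i) (is_derive_coord i dc).
exact: (is_deriveD
  (is_deriveD (is_deriveB (is_deriveN (D 0)) (D 1)) (D 2)) (D 3)).
Qed.

Lemma is_derive_Q c t : derivable c t 1 ->
  is_derive t 1 (fun s => Q (c s)) (2 * dotQ (c t) (derive1 c t)).
Proof.
move=> dc; have D i := is_deriveM (is_derive_coord i dc) (is_derive_coord i dc).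
have -> : (fun s => Q (c s)) =
    (fun s => - (c s 0 0 * c s 0 0) - c s 0 1 * c s 0 1 + c s 0 2 * c s 0 2
              + c s 0 3 * c s 0 3).
  by apply/funext => s; rewrite /Q -!expr2.
apply: (is_derive_eq (is_deriveD
  (is_deriveD (is_deriveB (is_deriveN (D 0)) (D 1)) (D 2)) (D 3))).
by rewrite /dotQ /GRing.scale/=; ring.
Qed.

Lemma curve_tangent c t : (forall s, Q (c s) = - 1) -> derivable c t 1 ->
  dotQ (c t) (derive1 c t) = 0.
Proof.
move=> Qc dc; have dQ := is_derive_Q dc.
have Qcst : (fun s => Q (c s)) = cst (- 1) by apply/funext => s; rewrite /= Qc.
have := @derive_val _ _ _ _ _ _ _ dQ; rewrite Qcst derive_cst => /esym/eqP.
by rewrite mulf_eq0 pnatr_eq0 /= => /eqP.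
Qed.

(** The restriction of [c] to [0, b] is extended by constants to the whole line. The Lipschitz
    condition becomes global, while the curve stays in [M] and has the same derivatives inside ]0,
    b[. *)
Lemma clamp_curve M I c b : past_causal_curve M I c -> I b ->
  exists c1 K D, [/\ forall t, M (c1 t),
    forall s t, `|c1 s - c1 t| <= K * `|s - t|,
    forall t, `|c1 t| <= D,
    forall t, 0 <= t <= b -> c1 t = c t
  & {ae mu, forall t, 0 < t < b -> [/\ derivable c1 t 1,
      past_causal_vector (c1 t) (derive1 c1 t) & derive1 c1 t = derive1 c t]}].
Proof.
move=> [[Iitv I0 Ige0] Mc lipc dc] Ib; have b0 := Ige0 _ Ib.
have FF : Filter (nbhs (almost_everywhere mu)).
  exact: ae_filter_ringOfSetsType.
pose cl t := Num.max 0 (Num.min t b).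
have cl_in t : 0 <= cl t <= b.
  by rewrite /cl le_max lexx /= ge_max b0 ge_min lexx orbT.
have I_in t : 0 <= t <= b -> I t by move=> h; exact: (Iitv _ _ I0 Ib).
have cl_id t : 0 <= t <= b -> cl t = t.
  by move=> /andP[at_ tb]; rewrite /cl (min_idPl tb) (max_idPr at_).
have cl_lip s t : `|cl s - cl t| <= `|s - t|.
  wlog st : s t / s <= t.
    by move=> H; case: (leP s t) => [/H//|/ltW/H]; rewrite distrC (distrC t).
  have cst_ : cl s <= cl t.
    by rewrite /cl ge_max !le_max lexx /= le_min !ge_min lexx st !orbT.
  rewrite distrC (distrC s) !ger0_norm ?subr_ge0//.
  rewrite /cl /Num.min /Num.max; do ![case: ifPn]; rewrite -?leNgt; lra.
(* The Lipschitz property provides all constants beyond some [K0]; the chosen one is moreover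
   nonnegative. *)
have [K0 [_ HK]] := lipc _ Ib; set K := `|K0| + 1.
have {}HK s t : `|c (cl s) - c (cl t)| <= K * `|cl s - cl t|.
  apply: (HK K _ (cl s, cl t)).
    by rewrite /K (le_lt_trans (ler_norm _))// ltrDl.
  by split; rewrite /= in_itv/= cl_in.
have K_ge0 : 0 <= K by rewrite addr_ge0.
exists (c \o cl), K, (`|c 0| + K * b); split.
- by move=> t; apply: Mc; exact: I_in.
- by move=> s t; apply: (le_trans (HK s t)); rewrite ler_wpM2l.
- move=> t; have := HK t 0; rewrite (cl_id 0) ?lexx// subr0 => H.
  rewrite /= -[c (cl t)](subrK (c 0)) addrC (le_trans (ler_normD _ _))// lerD2l.
  apply: (le_trans H); rewrite ler_wpM2l//.
  by have /andP[? ?] := cl_in t; rewrite ger0_norm.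
- by move=> t tb /=; rewrite cl_id.
- apply: filterS dc => t dct /andP[t0 tb].
  have tb' : 0 <= t <= b by rewrite !ltW.
  have [dct1 dct2] := dct (I_in _ tb').
  have near_cl : \near t, c t = (c \o cl) t.
    have /near_in_itvoo nab : t \in `]0, b[ by rewrite in_itv/= t0.
    near=> s; have : s \in `]0, b[ by near: s.
    by rewrite in_itv/= => /andP[/ltW as_ /ltW sb] /=; rewrite cl_id// as_.
  have e : derive1 (c \o cl) t = derive1 c t.
    by rewrite !derive1E (near_eq_derive _ near_cl).
  split; [exact: (near_eq_derivable near_cl dct1)| |exact: e].
  by rewrite e /= cl_id.
Unshelve. all: by end_near. Qed.

(* [N] plays the role of a gradient field for [G], up to normal components and
   the factor [- k]; [arccos G] grows at least at unit rate along past causal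
   curves on which [N] is timelike and points to the future. *)
Definition time_potential G N k : Prop :=
  [/\ 0 < k,
      forall D, exists K, forall x y, `|x| <= D -> `|y| <= D ->
        `|G x - G y| <= K * `|x - y|,
      continuous (fun x => om x (N x)) &
      forall c t, derivable c t 1 ->
        is_derive t 1 (G \o c) (- k * dotQ (N (c t)) (derive1 c t))].

(** For g = G o c, g' = -k <N|c'> is nonpositive, and reverse Cauchy-Schwarz with the bound on the
    gradient gives g'^2 >= (1 - g^2) l^2, where l is the length integrand. The start [a] is
    arbitrary so that the lemma also applies to the tail of a curve. *)
Lemma time_potential_curve M I c G N k a b :
  M `<=` AdS -> past_causal_curve M I c -> I b -> 0 <= a -> a <= b ->
  time_potential G N k ->
  (forall t, a <= t <= b -> -1 < G (c t)) ->
  (forall x, M x -> -1 < G x < 1 ->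
     1 - G x ^+ 2 <= k ^+ 2 * - (Q (N x) + dotQ x (N x) ^+ 2)) ->
  G (c a) < 1 -> 0 < om (c a) (N (c a)) ->
  (forall s t, a <= s -> s <= t -> t <= b -> G (c t) <= G (c s)) /\
  (\int[mu]_(t in `[a, b]) (Num.sqrt (- Q (derive1 c t)))%:E <=
   (pi - acos (G (c a)))%:E)%E.
Proof.
move=> MAdS cc Ib a0 ab [k0 lipG contN dG] GN1 GN Ga1 oma.
have [c1 [K [D [Mc1 lipc1 bdc1 c1E dc1]]]] := clamp_curve cc Ib.
have FF : Filter (nbhs (almost_everywhere mu)).
  exact: ae_filter_ringOfSetsType.
have [KG lipGc] := lipG D.
have QM x : M x -> Q x = - 1 by exact: MAdS.
have c1E' t : a <= t -> t <= b -> c1 t = c t.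
  by move=> at_ tb; rewrite c1E// tb (le_trans a0).
have KG0 t s : `|(G \o c1) t - (G \o c1) s| <= `|KG| * K * `|t - s|.
  apply: (le_trans (lipGc _ _ (bdc1 t) (bdc1 s))).
  rewrite -mulrA; apply: (@le_trans _ _ (`|KG| * `|c1 t - c1 s|)).
    by rewrite ler_wpM2r// ler_norm.
  by rewrite ler_wpM2l.
have timelike x : M x -> -1 < G x < 1 -> Q (N x) + dotQ x (N x) ^+ 2 < 0.
  move=> Mx Gx; have := GN x Mx Gx; have k20 : 0 < k ^+ 2 by rewrite exprn_gt0.
  rewrite -oppr_gt0 => H; rewrite -(pmulr_rgt0 _ k20); apply: lt_le_trans H.
  by move: Gx => /andP[? ?]; nra.
have [|||||t||] := @time_function_length R (G \o c1)
    (fun t => om (c1 t) (N (c1 t))) (fun t => Num.sqrt (- Q (derive1 c t)))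
    (`|KG| * K) a b ab KG0.
- move=> t; apply: (@continuous_comp _ _ _ c1 (fun x => om x (N x))).
    exact: klipschitz_continuous lipc1 t.
  exact: contN.
- by move=> t /andP[at_ tb] /=; rewrite c1E'//; apply: GN1; rewrite at_.
- by rewrite /= c1E'.
- by rewrite c1E'.
- move=> t /andP[at_ tb] /= Gt1; apply: om_neq0; first exact: QM.
  by apply: timelike => //; rewrite Gt1 andbT c1E'// GN1 ?at_.
- exact: sqrtr_ge0.
- apply: filterS dc1 => t dc1t /andP[at_ tb] /= Gt1 omt.
  have [|dc [w0 Qw omw] dcE] := dc1t; first by rewrite tb (le_lt_trans a0).
  have dGt := dG c1 t dc.
  have d1E : derive1 (G \o c1) t = - k * dotQ (N (c1 t)) (derive1 c1 t).
    by rewrite derive1E (@derive_val _ _ _ _ _ _ _ dGt).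
  have Gt : -1 < G (c1 t) < 1.
    by rewrite Gt1 andbT c1E' ?ltW// GN1// !ltW.
  have [P0 P1] := reverse_cauchy_schwarz (QM _ (Mc1 t))
    (curve_tangent (fun s => QM _ (Mc1 s)) dc) Qw omw (timelike _ (Mc1 t) Gt) omt.
  split; first by case: dGt.
    by rewrite d1E mulNr oppr_le0 mulr_ge0// ltW.
  rewrite d1E -dcE sqr_sqrtr ?oppr_ge0// exprMn sqrrN.
  apply: (@le_trans _ _ (k ^+ 2 * - (Q (N (c1 t)) + dotQ (c1 t) (N (c1 t)) ^+ 2)
      * - Q (derive1 c1 t))).
    by rewrite ler_wpM2r ?oppr_ge0// GN.
  by rewrite -mulrA ler_wpM2l ?sqr_ge0// mulrC.
move=> mono len; split; last by move: len; rewrite /= c1E'.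
move=> s t as_ st tb; have := mono s t as_ st tb.
by rewrite /= !c1E'// ?(le_trans as_)// (le_trans st).
Qed.

End Curves.

(** * The closed disc, its boundary circle and the boundary curve *)

Section Disc.
Context {R : realType}.
Implicit Types (p q y : 'rV[R]_3) (f : 'rV[R]_3 -> R) (S : set ('rV[R]_3 * R)).

Lemma dot3_bound p q : sphere p -> sphere q -> -1 <= dot3 p q <= 1.
Proof.
rewrite /sphere /dot3 /= => sp sq.
have := sqr_ge0 (p 0 0 - q 0 0); have := sqr_ge0 (p 0 1 - q 0 1).
have := sqr_ge0 (p 0 2 - q 0 2); have := sqr_ge0 (p 0 0 + q 0 0).
have := sqr_ge0 (p 0 1 + q 0 1); have := sqr_ge0 (p 0 2 + q 0 2).
by move=> *; apply/andP; split; nra.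
Qed.

Lemma sdistE p q : sphere p -> sphere q ->
  0 <= sdist p q <= pi /\ cos (sdist p q) = dot3 p q.
Proof. by move=> sp sq; apply/acos_def/dot3_bound. Qed.

Definition circle_point (a : R) : 'rV[R]_3 :=
  \row_(j < 3) [:: cos a; sin a; 0]`_j.

Lemma circle_point_bd a : bdD2 (circle_point a).
Proof.
split; last by rewrite mxE.
by rewrite /sphere /dot3 /= !mxE /= mulr0 addr0 -!expr2 cos2Dsin2.
Qed.

Lemma rV3P p q : p 0 0 = q 0 0 -> p 0 1 = q 0 1 -> p 0 2 = q 0 2 -> p = q.
Proof.
move=> e0 e1 e2; apply/rowP => -[[|[|[|//]]] i3].
- by rewrite (_ : Ordinal i3 = 0)//; exact/val_inj.
- by rewrite (_ : Ordinal i3 = 1)//; exact/val_inj.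
- by rewrite (_ : Ordinal i3 = 2)//; exact/val_inj.
Qed.

Lemma ord4P (P : 'I_4 -> Prop) : P 0 -> P 1 -> P 2 -> P 3 -> forall i, P i.
Proof.
move=> P0 P1 P2 P3 -[[|[|[|[|//]]]] i4].
- by rewrite (_ : Ordinal i4 = 0)//; exact/val_inj.
- by rewrite (_ : Ordinal i4 = 1)//; exact/val_inj.
- by rewrite (_ : Ordinal i4 = 2)//; exact/val_inj.
- by rewrite (_ : Ordinal i4 = 3)//; exact/val_inj.
Qed.

Lemma rV4P (x y : 'rV[R]_4) : x 0 0 = y 0 0 -> x 0 1 = y 0 1 ->
  x 0 2 = y 0 2 -> x 0 3 = y 0 3 -> x = y.
Proof. by move=> *; apply/rowP; exact: ord4P. Qed.

Lemma circle_point_onto y : bdD2 y ->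
  exists2 a, a \in `[- pi, pi] & y = circle_point a.
Proof.
rewrite /bdD2 /sphere /dot3 /= => -[+ y2]; rewrite y2 mulr0 addr0 => y01.
have y0 : -1 <= y 0 0 <= 1.
  by have := sqr_ge0 (y 0 1); move=> *; apply/andP; split; nra.
have [/andP[a0 ap] ca] := acos_def y0.
have sa : sin (acos (y 0 0)) = `|y 0 1|.
  by rewrite sin_acos// -sqrtr_sqr; congr Num.sqrt; rewrite !expr2; lra.
have [y10|y10] := leP 0 (y 0 1).
  exists (acos (y 0 0)); last first.
    by apply: rV3P; rewrite !mxE//= sa ger0_norm.
  by rewrite in_itv/= ap (le_trans _ a0)// oppr_le0 pi_ge0.
exists (- acos (y 0 0)).
  by rewrite in_itv/= lerN2 ap (le_trans _ (@pi_ge0 R))// oppr_le0.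
by apply: rV3P; rewrite !mxE//= ?cosN// sinN sa ltr0_norm// opprK.
Qed.

Lemma bdD2_clD2 y : bdD2 y -> clD2 y.
Proof. by move=> [sy y2]; split; rewrite // y2. Qed.

Lemma defining_map_circle_lip S f a b : defining_map S f ->
  `|f (circle_point a) - f (circle_point b)| <= `|a - b|.
Proof.
move=> [_ _ lipf].
have [ca cb] := (bdD2_clD2 (circle_point_bd a), bdD2_clD2 (circle_point_bd b)).
apply: (le_trans (lipf _ _ ca cb)); rewrite /sdist /dot3 !mxE /= mulr0 addr0.
by rewrite -cosB acos_cos_le.
Qed.

Definition boundary_ray f y : 'rV[R]_4 := ray_rep (y, f y).

Lemma dotQ_ray_rep p a q b :
  dotQ (ray_rep (p, a)) (ray_rep (q, b)) =
  - cos (a - b) + p 0 0 * q 0 0 + p 0 1 * q 0 1.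
Proof. by rewrite /dotQ /ray_rep !mxE /= cosB; ring. Qed.

Lemma dotQ_boundary_max S f (x : 'rV[R]_4) : defining_map S f ->
  exists2 y0, bdD2 y0 &
    forall y, bdD2 y -> dotQ x (boundary_ray f y) <= dotQ x (boundary_ray f y0).
Proof.
move=> Sf; have cf : continuous (f \o circle_point).
  move=> a; apply/cvgrPdist_lt => e e0; near=> b.
  apply: (le_lt_trans (defining_map_circle_lip a b Sf)).
  by near: b; exact: (nbhsx_ballx a e).
pose h a := dotQ x (boundary_ray f (circle_point a)).
have ch : continuous h.
  have -> : h = (fun a => - (x 0 0 * cos (f (circle_point a)))
      - x 0 1 * sin (f (circle_point a)) + x 0 2 * cos a + x 0 3 * sin a).
    by apply/funext => a; rewrite /h /dotQ /boundary_ray /ray_rep !mxE.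
  move=> a.
  have c1 : {for a, continuous (cos \o (f \o circle_point))}.
    by apply: continuous_comp; [exact: cf|exact: continuous_cos].
  have c2 : {for a, continuous (sin \o (f \o circle_point))}.
    by apply: continuous_comp; [exact: cf|exact: continuous_sin].
  apply: cvgD; [apply: cvgD; [apply: cvgB; [apply: cvgN|]|]|];
    apply: cvgM; try exact: cvg_cst.
  - exact: c1.
  - exact: c2.
  - exact: continuous_cos.
  - exact: continuous_sin.
have pp : - pi <= pi :> R by rewrite (le_trans _ (@pi_ge0 R))// oppr_le0 pi_ge0.
have [a0 _ a0max] := EVT_max pp (continuous_subspaceT ch).
exists (circle_point a0); first exact: circle_point_bd.
by move=> y /circle_point_onto[a aI ->]; exact: a0max.
Unshelve. all: by end_near. Qed.

(** The product equals - cos (f y - f (-y)) - 1, and the Lipschitz bound gives |f y - f (-y)| <= pi.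
    Equality would make [f] decrease at unit rate along a half great circle from one of the two
    points to the other, against strict contraction inside the disc. *)
Lemma dotQ_antipodal S f y : defining_map S f -> bdD2 y ->
  bdD2 (- y) /\ dotQ (boundary_ray f y) (boundary_ray f (- y)) < 0.
Proof.
move=> Sf ybd; have Nbd (z : 'rV[R]_3) : bdD2 z -> bdD2 (- z).
  move=> [sz z2]; split; last by rewrite mxE z2 oppr0.
  by move: sz; rewrite /sphere /dot3 /= !mxE !mulrNN.
split; first exact: Nbd.
have [_ contr lipf] := Sf.
have dN (z : 'rV[R]_3) : bdD2 z -> dot3 z (- z) = - 1.
  by move=> [sz _]; move: sz; rewrite /sphere /dot3 /= !mxE; lra.
have npi (z : 'rV[R]_3) : bdD2 z -> f z - f (- z) != pi.
  move=> zbd; apply/eqP => fz.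
  have [[sz z2] Nzbd] := (zbd, Nbd _ zbd).
  have pi0 := @pi_gt0 R.
  pose a : R := pi / 4.
  have a0 : 0 < a by rewrite divr_gt0.
  have aE : a * 4 = pi by rewrite /a divfK.
  have ca : 0 < cos a by apply: cos_gt0_pihalf; lra.
  have sa : 0 < sin a by apply: sin_gt0_pi; lra.
  pose o : 'rV[R]_3 := \row_(j < 3) [:: 0; 0; 1]`_j.
  (* The point at distance pi/4 from [z] on the great arc from [z] through the pole [o] to [- z].
     The Lipschitz bounds to both ends determine [f p] and [f o], whose difference is then exactly
     the distance from [p] to [o]. *)
  pose p : 'rV[R]_3 := \row_(j < 3) [:: cos a * z 0 0; cos a * z 0 1; sin a]`_j.
  have ez : z 0 0 * z 0 0 + z 0 1 * z 0 1 = 1.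
    by move: sz; rewrite /sphere /dot3 /= z2; lra.
  have Do : D2 o by split; rewrite /sphere /dot3 /= !mxE /=; lra.
  have Dp : D2 p.
    split; rewrite /sphere /dot3 /= !mxE //=.
    transitivity (cos a ^+ 2 * (z 0 0 * z 0 0 + z 0 1 * z 0 1) + sin a ^+ 2).
      by ring.
    by rewrite ez mulr1 cos2Dsin2.
  have clD q : D2 q -> clD2 q by move=> [sq q2]; split => //; exact: ltW.
  have dpz : sdist p z = a.
    rewrite /sdist (_ : dot3 p z = cos a); first by rewrite cosK// in_itv/=; lra.
    rewrite /dot3 !mxE /= z2.
    by transitivity (cos a * (z 0 0 * z 0 0 + z 0 1 * z 0 1)); [ring|rewrite ez mulr1].
  have doz : sdist o z = pi / 2.
    rewrite /sdist (_ : dot3 o z = 0) ?acos0//.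
    by rewrite /dot3 !mxE /= z2; ring.
  have dpNz : sdist p (- z) = pi - a.
    rewrite -dpz /sdist -acosN; last exact: dot3_bound Dp.1 sz.
    by congr acos; rewrite /dot3 !mxE; ring.
  have doNz : sdist o (- z) = pi - pi / 2.
    rewrite -doz /sdist -acosN; last exact: dot3_bound Do.1 sz.
    by congr acos; rewrite /dot3 !mxE; ring.
  have dpo : sdist p o = pi / 2 - a.
    rewrite /sdist (_ : dot3 p o = cos (pi / 2 - a)).
      by rewrite cosK// in_itv/=; lra.
    by rewrite -cosN opprB cosBpihalf /dot3 !mxE /=; ring.
  have po : p != o.
    apply/eqP => po; have : dot3 p z = dot3 o z by rewrite po.
    rewrite /dot3 !mxE /= z2 => e.
    have : cos a * (z 0 0 * z 0 0 + z 0 1 * z 0 1) = 0 by lra.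
    by rewrite ez mulr1; lra.
  have := contr _ _ Dp Do po; rewrite dpo.
  have [zc Nzc] := (bdD2_clD2 zbd, bdD2_clD2 Nzbd).
  have := lipf _ _ (clD _ Dp) zc; rewrite dpz ler_norml.
  have := lipf _ _ (clD _ Dp) Nzc; rewrite dpNz ler_norml.
  have := lipf _ _ (clD _ Do) zc; rewrite doz ler_norml.
  have := lipf _ _ (clD _ Do) Nzc; rewrite doNz ler_norml.
  by rewrite ltr_norml; lra.
have := lipf _ _ (bdD2_clD2 ybd) (bdD2_clD2 (Nbd _ ybd)).
rewrite /sdist dN// acosN1 => fle.
have flt : `|f y - f (- y)| < pi.
  rewrite lt_neqAle fle andbT eqr_norml negb_and negb_or npi//=.
  have := npi _ (Nbd _ ybd); rewrite opprK -opprB eqr_oppLR => ->.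
  by [].
have := ltr_cos_pi (normr_ge0 _) flt (lexx _); rewrite cospi cos_norm => c1.
rewrite dotQ_ray_rep !mxE.
have := dN _ ybd; case: ybd => _ y2; rewrite /dot3 !mxE y2; lra.
Qed.

End Disc.

(** * The invisible domain in the linear model *)

Section InvisibleDomain.
Context {R : realType}.
Implicit Types (p q y : 'rV[R]_3) (f : 'rV[R]_3 -> R) (S : set ('rV[R]_3 * R)).
Implicit Types (x : 'rV[R]_4) (t e : R).

Lemma projE p t : D2 p -> proj (p, t) = (p 0 2)^-1 *: ray_rep (p, t).
Proof.
move=> [sp p2]; rewrite /proj /ads_of_ray /=.
have -> : Q (ray_rep (p, t)) = - p 0 2 ^+ 2.
  rewrite /Q /ray_rep !mxE /=; have := cos2Dsin2 t.
  by move: sp; rewrite /sphere /dot3 /= -!expr2; lra.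
by rewrite opprK sqrtr_sqr gtr0_norm.
Qed.

(** The dictionary between the two models: the sign of the product compares |t - f y| with d(p, y)
    as long as both lie in [0, pi]. *)
Lemma dotQ_proj f p t y : D2 p -> bdD2 y ->
  dotQ (proj (p, t)) (boundary_ray f y) =
  (p 0 2)^-1 * (cos (sdist p y) - cos `|t - f y|).
Proof.
move=> Dp [sy y2]; have [_ ->] := sdistE Dp.1 sy.
rewrite projE// dotQZl dotQ_ray_rep /= cos_norm /dot3 y2; congr (_ * _).
by ring.
Qed.

Lemma defining_map_bounded S f : defining_map S f ->
  exists B, forall y, bdD2 y -> `|f y| <= B.
Proof.
move=> [_ _ lipf]; have bd0 := circle_point_bd (0 : R).
exists (`|f (circle_point 0)| + pi) => y ybd.
have := lipf _ _ (bdD2_clD2 ybd) (bdD2_clD2 bd0) => fle.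
rewrite -(subrK (f (circle_point 0)) (f y)) addrC.
rewrite (le_trans (ler_normD _ _))// lerD2l (le_trans fle)//.
by have [/andP[]] := sdistE ybd.1 bd0.1.
Qed.

(** Boundedness of [f] on the circle ensures that [sup] and [inf] are genuine bounds and not default
    values. *)
Lemma invisible_cover_lt S f p t y : defining_map S f ->
  invisible_cover f (p, t) -> bdD2 y -> `|t - f y| < sdist p y.
Proof.
move=> /defining_map_bounded[B fB] [/= Dp supt tinf] ybd.
have d_bd z : bdD2 z -> 0 <= sdist p z <= pi.
  by move=> [sz _]; have [] := sdistE Dp.1 sz.
have hs : f y - sdist p y <= sup [set f y - sdist p y | y in bdD2].
  apply: ub_le_sup; last by exists y.
  exists (B + pi) => _ [z zbd <-].
  by have := fB z zbd; have := d_bd z zbd; rewrite ler_norml; lra.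
have hi : inf [set f y + sdist p y | y in bdD2] <= f y + sdist p y.
  apply: ge_inf; last by exists y.
  exists (- B - pi) => _ [z zbd <-].
  by have := fB z zbd; have := d_bd z zbd; have := @pi_gt0 R; rewrite ler_norml; lra.
by rewrite ltr_norml; lra.
Qed.

(** The uniform margin [e] keeps the inequalities strict after passing to [sup] and [inf]. *)
Lemma invisible_coverI f p t e : D2 p -> 0 < e ->
  (forall y, bdD2 y -> `|t - f y| <= sdist p y - e) -> invisible_cover f (p, t).
Proof.
move=> Dp e0 H; have bd0 := circle_point_bd (0 : R); split => //=.
- apply: (@le_lt_trans _ _ (t - e)); last lra.
  apply: ge_sup.
    by exists (f (circle_point 0) - sdist p (circle_point 0)), (circle_point 0).
  by move=> _ [z zbd <-]; have := H z zbd; rewrite ler_norml; lra.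
- apply: (@lt_le_trans _ _ (t + e)); first lra.
  apply: lb_le_inf.
    by exists (f (circle_point 0) + sdist p (circle_point 0)), (circle_point 0).
  by move=> _ [z zbd <-]; have := H z zbd; rewrite ler_norml; lra.
Qed.

Lemma invisible_domain_AdS f : invisible_domain f `<=` AdS.
Proof. by move=> _ [[p t] [Dp _ _] <-]; exact: proj_AdS. Qed.

Lemma invisible_domain_lt0 S f x y : defining_map S f ->
  invisible_domain f x -> bdD2 y -> dotQ x (boundary_ray f y) < 0.
Proof.
move=> Sf [[p t] pt <-] ybd; have [Dp _ _] := pt.
have lt := invisible_cover_lt Sf pt ybd.
have [/andP[d0 dpi] _] := sdistE Dp.1 ybd.1.
rewrite dotQ_proj// pmulr_rlt0 ?invr_gt0; last exact: Dp.2.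
by rewrite subr_lt0 ltr_cos_pi.
Qed.

(** Negative products with the boundary rays determine [theta] only modulo 2 pi. A nearby point [x1]
    of the domain selects the sheet: [x] is lifted next to the lift of [x1], and the margin [e]
    excludes that |t - f y| reaches pi in between. *)
Lemma invisible_domain_closure S f x : defining_map S f ->
  closure (invisible_domain f) x -> Q x = - 1 ->
  (forall y, bdD2 y -> dotQ x (boundary_ray f y) < 0) -> invisible_domain f x.
Proof.
move=> Sf clx Qx xneg.
have [y0 y0bd y0max] := dotQ_boundary_max x Sf.
pose e := - dotQ x (boundary_ray f y0).
have e0 : 0 < e by rewrite oppr_gt0 xneg.
have xe y : bdD2 y -> dotQ x (boundary_ray f y) <= - e.
  by rewrite /e opprK; exact: y0max.
pose r := Num.sqrt (x 0 0 ^+ 2 + x 0 1 ^+ 2).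
have r2E : x 0 0 ^+ 2 + x 0 1 ^+ 2 = 1 + x 0 2 ^+ 2 + x 0 3 ^+ 2.
  by move: Qx; rewrite /Q; lra.
have r2 : r ^+ 2 = x 0 0 ^+ 2 + x 0 1 ^+ 2.
  by rewrite sqr_sqrtr// addr_ge0 ?sqr_ge0.
have r0 : 0 < r.
  rewrite sqrtr_gt0 r2E; have := sqr_ge0 (x 0 2); have := sqr_ge0 (x 0 3); lra.
(* A threshold for the cosine of the angle between the (u, v) parts of [x] and [x1]. Being at least
   0, it keeps this angle in the range of [asin]; being at least 1 - e/r, it yields the
   contradiction at |t - f y| >= pi. *)
pose k := Num.max 0 (1 - e / r).
have k0 : 0 <= k by rewrite /k le_max lexx.
have k1 : k < 1 by rewrite /k gt_max ltr01 /= ltrBlDr ltrDl divr_gt0.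
have ke : 1 - e / r <= k by rewrite /k le_max lexx orbT.
(* Positivity of [h] means that the cosine of the angle between the (u, v) parts of [x] and [z]
   exceeds [k], for a nonzero part of [z]. *)
pose h (z : 'rV[R]_4) := x 0 0 * z 0 0 + x 0 1 * z 0 1 -
   k * r * Num.sqrt (z 0 0 * z 0 0 + z 0 1 * z 0 1).
have ch : {for x, continuous h}.
  have cz i : {for x, continuous (fun z : 'rV[R]_4 => z 0 i)}.
    exact: coord_continuous.
  have c2 : {for x, continuous
      (Num.sqrt \o (fun z : 'rV[R]_4 => z 0 0 * z 0 0 + z 0 1 * z 0 1))}.
    apply: continuous_comp; last exact: sqrt_continuous.
    by apply: continuousD; apply: continuousM; exact: cz.
  apply: continuousB; last by apply: continuousM; [exact: cst_continuous|exact: c2].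
  by apply: continuousD; apply: continuousM; (exact: cst_continuous || exact: cz).
have hx : 0 < h x.
  have -> : h x = (1 - k) * r ^+ 2 by rewrite /h -!expr2 -/r -r2; ring.
  by rewrite mulr_gt0 ?subr_gt0 ?exprn_gt0.
have [x1 [x1M hx1]] : invisible_domain f `&` [set z | 0 < h z] !=set0.
  by apply: clx; exact: (cvgr_gt (h x) ch _ hx).
have [[p1 t1] M1 x1E] := x1M; have [/= Dp1 _ _] := M1.
have p1_gt0 : 0 < (p1 0 2)^-1 by rewrite invr_gt0 Dp1.2.
pose C := (x 0 0 * cos t1 + x 0 1 * sin t1) / r.
pose s := (x 0 1 * cos t1 - x 0 0 * sin t1) / r.
have r_neq0 : r != 0 by rewrite gt_eqF.
have kC : k < C.
  move: hx1; rewrite -x1E projE// /h /= !mxE /= -!expr2 !exprMn -mulrDr cos2Dsin2 mulr1.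
  rewrite sqrtr_sqr gtr0_norm// => hx1.
  have : 0 < (p1 0 2)^-1 * (x 0 0 * cos t1 + x 0 1 * sin t1 - k * r) by lra.
  by rewrite pmulr_rgt0// subr_gt0 /C ltr_pdivlMr.
have Cs : C ^+ 2 + s ^+ 2 = 1.
  transitivity ((x 0 0 ^+ 2 + x 0 1 ^+ 2) * (cos t1 ^+ 2 + sin t1 ^+ 2) / r ^+ 2).
    by rewrite /C /s; field.
  by rewrite cos2Dsin2 mulr1 -r2 divff// expf_neq0.
(* [C] and [s] are the cosine and sine of the angle from the (u, v) part of [x1] to that of [x], so
   t1 + asin s is an argument of the latter. *)
have s1 : -1 <= s <= 1 by have := sqr_ge0 C; move=> *; apply/andP; split; nra.
pose al := asin s; pose t := t1 + al.
have [/andP[al_ge al_le] sin_al] := asin_def s1.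
have cos_al : cos al = C.
  rewrite /al cos_asin// (_ : 1 - s ^+ 2 = C ^+ 2); last by lra.
  by rewrite sqrtr_sqr ger0_norm// (le_trans k0)// ltW.
have cos_t : cos t * r = x 0 0.
  rewrite /t cosD cos_al sin_al /C /s mulrBl !mulrA !divfK//.
  transitivity (x 0 0 * (cos t1 ^+ 2 + sin t1 ^+ 2)); first by ring.
  by rewrite cos2Dsin2 mulr1.
have sin_t : sin t * r = x 0 1.
  rewrite /t sinD cos_al sin_al /C /s mulrDl !mulrA !divfK//.
  transitivity (x 0 1 * (cos t1 ^+ 2 + sin t1 ^+ 2)); first by ring.
  by rewrite cos2Dsin2 mulr1.
pose p : 'rV[R]_3 := \row_(j < 3) [:: x 0 2 / r; x 0 3 / r; r^-1]`_j.
have Dp : D2 p.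
  split; last by rewrite mxE /= invr_gt0.
  rewrite /sphere /dot3 /= !mxE /=.
  transitivity ((1 + x 0 2 ^+ 2 + x 0 3 ^+ 2) / r ^+ 2); first by field.
  by rewrite r2 r2E divff// -r2E -r2 expf_neq0.
have xE : proj (p, t) = x.
  rewrite projE// mxE /= invrK; apply: rV4P; rewrite !mxE /= ?mxE /=.
  - by rewrite mulrC.
  - by rewrite mulrC.
  - by rewrite mulrC divfK.
  - by rewrite mulrC divfK.
exists (p, t) => //; apply: (@invisible_coverI f p t (e / r)) => //.
  by rewrite divr_gt0.
move=> y ybd; have [/andP[d0 dpi] _] := sdistE Dp.1 ybd.1.
have [/andP[_ d1pi] _] := sdistE Dp1.1 ybd.1.
have dlt1 := invisible_cover_lt Sf M1 ybd.
set de := `|t - f y|; set d := sdist p y in d0 dpi *.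
have de0 : 0 <= de by exact: normr_ge0.
have cos_le : e / r <= cos de - cos d.
  have := xe y ybd; rewrite -xE dotQ_proj// mxE /= invrK.
  by rewrite -/de -/d ler_pdivrMr// => H; lra.
have de_al : de <= `|t1 - f y| + `|al|.
  by rewrite /de /t addrAC ler_normD.
have al_pi : `|al| <= pi / 2 by rewrite ler_norml al_ge.
(* Since |t1 - f y| < pi, an excess of [de] over pi is at most |al|, so that cos de <= -C < -1 +
   e/r. But [cos_le] gives cos de >= cos d + e/r >= -1 + e/r. *)
have de_pi : de < pi.
  rewrite ltNge; apply/negP => pide.
  have b0 : 0 <= de - pi by rewrite subr_ge0.
  have bal : de - pi <= `|al| by lra.
  have cb : C <= cos (de - pi).
    rewrite -cos_al -cos_norm; apply: ler_cos_pi => //.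
    by have := @pi_gt0 R; lra.
  have cosde : cos (de - pi) = - cos de.
    by have := cosDpi (de - pi); rewrite subrK => ->; rewrite opprK.
  by have := cos_geN1 d; lra.
have er0 : 0 < e / r by rewrite divr_gt0.
have ded : de < d.
  rewrite ltNge; apply/negP => dde.
  by have := ler_cos_pi d0 dde (ltW de_pi); lra.
by have := cos_sub_le (ltW ded); lra.
Qed.

(* If [<x|x'> >= 1], the segment from [x] to [x'] meets the null cone at a
   vector [N] whose ray lies over a point [y] of the circle; then
   [<N|boundary_ray f y> >= 0]. *)
Lemma dotQ_lt1 f x x' : Q x = - 1 -> Q x' = - 1 ->
  (forall y, bdD2 y -> dotQ x (boundary_ray f y) < 0) ->
  (forall y, bdD2 y -> dotQ x' (boundary_ray f y) < 0) -> dotQ x x' < 1.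
Proof.
move=> Qx Qx' xneg x'neg; rewrite ltNge; apply/negP => b1.
set b := dotQ x x' in b1 *.
have D0 : 0 <= b ^+ 2 - 1 by nra.
(* The smaller root of s^2 - 2bs + 1, which is - Q (x + s x'); it is positive because the two roots
   have sum 2b and product 1. *)
pose s := b - Num.sqrt (b ^+ 2 - 1).
have sq := sqr_sqrtr D0; have sq0 := sqrtr_ge0 (b ^+ 2 - 1).
have s0 : 0 < s by rewrite /s subr_gt0; nra.
pose N := x + s *: x'.
have QN : Q N = 0.
  by rewrite /N QD QZ dotQZ Qx Qx' -/b /s; move: sq; set w := Num.sqrt _ => sq; nra.
have Nneg y : bdD2 y -> dotQ N (boundary_ray f y) < 0.
  move=> ybd; rewrite /N dotQDl dotQZl.
  have := xneg y ybd; have := x'neg y ybd; nra.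
clearbody N.
pose r := Num.sqrt (N 0 2 ^+ 2 + N 0 3 ^+ 2).
have r2 : r ^+ 2 = N 0 2 ^+ 2 + N 0 3 ^+ 2 by rewrite sqr_sqrtr// addr_ge0 ?sqr_ge0.
have r2' : r ^+ 2 = N 0 0 ^+ 2 + N 0 1 ^+ 2 by move: QN; rewrite /Q; lra.
have r_ge0 : 0 <= r by exact: sqrtr_ge0.
have [r0|r0] := eqVneq r 0.
  have N0 : N = 0.
    have z (a c : R) : a ^+ 2 + c ^+ 2 = 0 -> a = 0 /\ c = 0.
      by move=> /eqP; rewrite paddr_eq0 ?sqr_ge0// !sqrf_eq0 => /andP[/eqP-> /eqP->].
    move: r2 r2'; rewrite r0 expr0n/= => /esym/z[e2 e3] /esym/z[e0 e1].
    by apply: rV4P; rewrite [RHS]mxE.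
  have := Nneg _ (circle_point_bd 0); rewrite N0 /dotQ !mxE; lra.
pose y : 'rV[R]_3 := \row_(j < 3) [:: N 0 2 / r; N 0 3 / r; 0]`_j.
have ybd : bdD2 y.
  split; last by rewrite mxE.
  rewrite /sphere /dot3 /= !mxE /=.
  transitivity ((N 0 2 ^+ 2 + N 0 3 ^+ 2) / r ^+ 2); first by field.
  by rewrite -r2 divff// expf_neq0.
have := Nneg _ ybd; rewrite /boundary_ray /dotQ /ray_rep !mxE /=.
have -> : N 0 2 * (N 0 2 / r) = N 0 2 ^+ 2 / r by rewrite mulrA expr2.
have -> : N 0 3 * (N 0 3 / r) = N 0 3 ^+ 2 / r by rewrite mulrA expr2.
rewrite -addrA -mulrDl -r2 expr2 mulfK//.
have cs := cos2Dsin2 (f y).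
set u := cos _ in cs *; set v := sin _ in cs *; move=> H.
have : N 0 0 * u + N 0 1 * v <= r.
  rewrite leNgt; apply/negP => H'.
  have : r ^+ 2 < (N 0 0 * u + N 0 1 * v) ^+ 2 by rewrite ltr_sqr ?nnegrE//; lra.
  have := sqr_ge0 (N 0 0 * v - N 0 1 * u).
  have : (N 0 0 * u + N 0 1 * v) ^+ 2 + (N 0 0 * v - N 0 1 * u) ^+ 2 =
    (N 0 0 ^+ 2 + N 0 1 ^+ 2) * (u ^+ 2 + v ^+ 2) by ring.
  by rewrite cs mulr1 -r2'; lra.
by lra.
Qed.

End InvisibleDomain.

(** * Exhaustion of parameter intervals and limits of monotone functions *)

Section Exhaustion.
Context {R : realType}.
Notation mu := (@lebesgue_measure R).

(** An interval starting at 0 is an increasing union of segments [0, F n]. [F] is constant if there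
    is a maximum, F n = n if the interval is unbounded, and F n tends to the supremum otherwise. *)
Lemma integral_parameter_interval_le (I : set R) (f : R -> \bar R) (C : \bar R) :
  parameter_interval I -> (forall t, 0 <= f t)%E ->
  (forall b, I b -> \int[mu]_(t in `[0%R, b]) f t <= C)%E ->
  (\int[mu]_(t in I) f t <= C)%E.
Proof.
move=> [Iitv I0 Ige0] f0 H.
have mI : measurable I by exact: is_interval_measurable.
have Isub b : I b -> `[0, b] `<=` I.
  by move=> Ib t /=; rewrite in_itv/= => tb; exact: (Iitv _ _ I0 Ib).
suff [F [ndF IF FI]] : exists F : R ^nat, [/\ nondecreasing_seq F,
    forall n, I (F n) & forall t, I t -> exists n, t <= F n].
  apply: (@integral_le_exhaustion _ _ _ mu I (fun n => `[0, F n]%classic)) => //.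
  - by move=> m n mn; apply/subsetPset; apply: subset_itvl; rewrite bnd_simp ndF.
  - apply/seteqP; split => [t [n _]|t It]; first exact: Isub.
    have [n tn] := FI t It; exists n => //=.
    by rewrite in_itv/= Ige0.
  - by move=> n; exact: H.
have [[b Ib bmax]|nomax] := pselect (exists2 b, I b & forall t, I t -> t <= b).
  by exists (fun=> b); split => // t It; exists 0%N; exact: bmax.
have {}nomax b : I b -> exists2 t, I t & b < t.
  move=> Ib; apply: contrapT => nt; apply: nomax; exists b => // t It.
  by rewrite leNgt; apply/negP => bt; apply: nt; exists t.
have Iin t b : 0 <= t -> I b -> t <= b -> I t.
  by move=> t0 Ib tb; apply: (Iitv _ _ I0 Ib); rewrite t0.
have [ubI|nubI] := pselect (has_ubound I); last first.
  have Iall t : 0 <= t -> I t.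
    move=> t0; apply: contrapT => nIt; apply: nubI; exists t => b Ib.
    by rewrite leNgt; apply/negP => /ltW tb; apply: nIt; exact: Iin Ib tb.
  exists (fun n => n%:R); split; first by move=> m n; rewrite ler_nat.
    by move=> n; exact: Iall.
  by move=> t It; exists (Num.bound t); rewrite ltW// archi_boundP// Ige0.
have supI b : I b -> b < sup I.
  move=> Ib; have [t It bt] := nomax b Ib; apply: (lt_le_trans bt).
  exact: ub_le_sup.
have s0 := supI _ I0; set s := sup I in supI s0.
exists (fun n => s - s / n.+1%:R); split.
- move=> m n mn; rewrite lerD2l lerN2 ler_pM2l// lef_pV2 ?posrE//.
  by rewrite ler_nat.
- move=> n; have sn : s - s / n.+1%:R < s by rewrite ltrBlDr ltrDl divr_gt0.
  have [|t It st] := @sup_gt _ I _ _ sn; first by exists 0.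
  apply: Iin It (ltW st); rewrite subr_ge0 ler_pdivrMr//.
  by rewrite ler_peMr ?(ltW s0)// ler1n.
- move=> t /supI ts; have st0 : 0 < s - t by rewrite subr_gt0.
  exists (Num.bound (s / (s - t))); set n := Num.bound _.
  have : s / (s - t) < n.+1%:R.
    apply: lt_le_trans (_ : n%:R <= _); last by rewrite ler_nat.
    by rewrite archi_boundP// divr_ge0 ?ltW.
  rewrite ltr_pdivrMr// => sn.
  have : s / n.+1%:R <= s - t by rewrite ler_pdivrMr// mulrC ltW.
  by rewrite lerBrDr addrC -lerBrDr.
Qed.

Lemma nonincreasing_cvg_pinfty (g : R -> R) (m : R) :
  (forall s t, 0 <= s -> s <= t -> g t <= g s) -> (forall t, 0 <= t -> m <= g t) ->
  exists l : R, g t @[t --> +oo] --> l.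
Proof.
move=> g_ni g_lb; pose A := g @` [set t | 0 <= t].
have lbA : has_lbound A by exists m => _ [t /= t0 <-]; exact: g_lb.
have A0 : A !=set0 by exists (g 0), 0 => /=.
exists (inf A); apply/cvgrPdist_lt => e e0.
have [|_ [t0 /= t0_ge0 <-] gt0] := @inf_lt _ A (inf A + e) A0; first by rewrite ltrDl.
near=> t; have tt0 : t0 <= t by near: t; exact: nbhs_pinfty_ge (num_real _).
have h1 : inf A <= g t by apply: ge_inf => //; exists t => //=; exact: le_trans tt0.
have h2 := g_ni _ _ t0_ge0 tt0.
by rewrite ltr_norml; lra.
Unshelve. all: by end_near. Qed.

End Exhaustion.

(** * The two families of potentials: linear functions and products of two of them *)

Section Potentials.
Context {R : realType}.
Notation E := 'rV[R]_4.
Implicit Types (x y z e : E) (G : E -> R) (N : E -> E) (k d : R).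

Lemma dotQ_norm_le z x : `|dotQ z x| <= 4 * `|z| * `|x|.
Proof.
have h i : `|z 0 i * x 0 i| <= `|z| * `|x|.
  by rewrite normrM ler_pM// coord_le_norm.
move: (h 0) (h 1) (h 2) (h 3); rewrite /dotQ !ler_norml => *; lra.
Qed.

Lemma dotQ_lip z x y : `|dotQ z x - dotQ z y| <= 4 * `|z| * `|x - y|.
Proof.
have -> : dotQ z x - dotQ z y = dotQ z (x - y).
  by rewrite -[- y]scaleN1r dotQD dotQZ; ring.
exact: dotQ_norm_le.
Qed.

Lemma coordE_continuous i : continuous (fun x => x 0 i).
Proof. by move=> x; exact: coord_continuous. Qed.

Lemma dotQ_continuous z : continuous (dotQ z).
Proof.
move=> x; have cz i : {for x, continuous (fun w : E => z 0 i * w 0 i)}.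
  by apply: continuousM; [exact: cst_continuous|exact: coordE_continuous].
apply: (@continuousD _ _ _ _ _ x _ (cz 3)).
apply: (@continuousD _ _ _ _ _ x _ (cz 2)).
apply: (@continuousB _ _ _ _ _ x _ (cz 1)).
exact: continuousN (cz 0).
Qed.

Lemma om_continuous N : (forall i, continuous (fun x => N x 0 i)) ->
  continuous (fun x => om x (N x)).
Proof.
move=> cN x.
apply: (@continuousB _ _ _ (fun x => x 0 0 * N x 0 1) (fun x => x 0 1 * N x 0 0));
  apply: continuousM;
  (exact: coordE_continuous || exact: cN).
Qed.

Lemma time_potentialN G N k : time_potential G N k ->
  time_potential (fun x => - G x) (fun x => - N x) k.
Proof.
move=> [k0 lipG cN dG]; split; [exact: k0| | |].
- move=> D; have [K HK] := lipG D; exists K => x y xD yD.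
  by rewrite -opprD normrN HK.
- have -> : (fun x => om x (- N x)) = (fun x => - om x (N x)).
    by apply/funext => x; rewrite /om !mxE; ring.
  by move=> x; apply: (@continuousN _ _ _ (fun x => om x (N x))); exact: cN.
- move=> c t dc; have dGt := dG c t dc.
  apply: (is_derive_eq (is_deriveN dGt)).
  by rewrite /dotQ !mxE; ring.
Qed.

(** For k = 1 / sqrt (- Q z) and values in ]-1, 1[, the arccosine of this function on AdS is the
    timelike distance to the point k z. *)
Lemma time_potential_dotQ z k : 0 < k ->
  time_potential (fun x => - k * dotQ z x) (fun=> z) k.
Proof.
move=> k0; split; [exact: k0| | |].
- move=> D; exists (k * (4 * `|z|)) => x y _ _.
  rewrite -mulrBr normrM normrN (gtr0_norm k0) -mulrA ler_pM2l//.
  exact: dotQ_lip.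
- by apply: om_continuous => i x; exact: cst_continuous.
- by move=> c t dc; exact: is_deriveZ (is_derive_dotQ z dc).
Qed.

(* [pi - arccos] of this function is, where it lies in [-1, 1[, twice the
   timelike distance from the spacelike geodesic with end points [y1], [y2]. *)
Definition geodesic_potential (y1 y2 : E) (x : E) : R :=
  4 / - dotQ y1 y2 * (dotQ y1 x * dotQ y2 x) - 1.

Definition geodesic_gradient (y1 y2 : E) (x : E) : E :=
  (- dotQ y2 x) *: y1 + (- dotQ y1 x) *: y2.

Lemma time_potential_geodesic y1 y2 : dotQ y1 y2 < 0 ->
  time_potential (geodesic_potential y1 y2) (geodesic_gradient y1 y2)
    (4 / - dotQ y1 y2).
Proof.
move=> y12; have k0 : 0 < 4 / - dotQ y1 y2 by rewrite divr_gt0// oppr_gt0.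
set k := 4 / _ in k0 *; split; [exact: k0| | |].
- move=> D; exists (k * (32 * `|y1| * `|y2| * D)) => x y xD yD.
  rewrite /geodesic_potential -/k opprD addrACA subrr addr0 -mulrBr normrM.
  rewrite (gtr0_norm k0) -[leRHS]mulrA ler_pM2l//.
  have -> : dotQ y1 x * dotQ y2 x - dotQ y1 y * dotQ y2 y =
      dotQ y1 x * (dotQ y2 x - dotQ y2 y) + (dotQ y1 x - dotQ y1 y) * dotQ y2 y.
    by ring.
  apply: (le_trans (ler_normD _ _)); rewrite !normrM.
  have h1 : `|dotQ y1 x| * `|dotQ y2 x - dotQ y2 y| <=
      (4 * `|y1| * D) * (4 * `|y2| * `|x - y|).
    apply: ler_pM => //; last exact: dotQ_lip.
    by apply: (le_trans (dotQ_norm_le _ _)); rewrite ler_wpM2l// mulr_ge0.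
  have h2 : `|dotQ y1 x - dotQ y1 y| * `|dotQ y2 y| <=
      (4 * `|y1| * `|x - y|) * (4 * `|y2| * D).
    apply: ler_pM => //; first exact: dotQ_lip.
    by apply: (le_trans (dotQ_norm_le _ _)); rewrite ler_wpM2l// mulr_ge0.
  apply: (le_trans (lerD h1 h2)).
  by rewrite le_eqVlt; apply/orP; left; apply/eqP; ring.
- apply: om_continuous => i x.
  have -> : (fun x => geodesic_gradient y1 y2 x 0 i) =
      (fun x => - dotQ y2 x * y1 0 i + - dotQ y1 x * y2 0 i).
    by apply/funext => z; rewrite !mxE.
  have cM y (a : R) : {for x, continuous (fun w => - dotQ y w * a)}.
    apply: (@continuousM _ _ (fun w => - dotQ y w) (cst a)).
      by apply: (@continuousN _ _ _ (dotQ y)); exact: dotQ_continuous.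
    exact: cst_continuous.
  exact: continuousD (cM y2 _) (cM y1 _).
- move=> c t dc.
  have dM := is_deriveM (is_derive_dotQ y1 dc) (is_derive_dotQ y2 dc).
  have dG := is_deriveB (is_deriveZ k dM) (is_derive_cst (1 : R) t 1).
  apply: (is_derive_eq dG).
  by rewrite /geodesic_gradient dotQDl !dotQZl /GRing.scale /= -/k; ring.
Qed.

(** The right side is exactly 4 times the left one, since the arccosine of the potential varies at
    twice the rate of a timelike distance. *)
Lemma geodesic_potential_bound y1 y2 x : Q y1 = 0 -> Q y2 = 0 ->
  dotQ y1 y2 < 0 -> -1 < geodesic_potential y1 y2 x < 1 ->
  let N := geodesic_gradient y1 y2 x in
  1 - geodesic_potential y1 y2 x ^+ 2 <=
  (4 / - dotQ y1 y2) ^+ 2 * - (Q N + dotQ x N ^+ 2).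
Proof.
move=> Q1 Q2 y12 /andP[g1 g2] /=.
have g0 : 0 <= 1 - geodesic_potential y1 y2 x ^+ 2 by nra.
suff -> : (4 / - dotQ y1 y2) ^+ 2 * - (Q (geodesic_gradient y1 y2 x) +
    dotQ x (geodesic_gradient y1 y2 x) ^+ 2) =
    4 * (1 - geodesic_potential y1 y2 x ^+ 2) by lra.
rewrite /geodesic_potential /geodesic_gradient QD !QZ Q1 Q2 dotQZl dotQZ.
rewrite dotQD !dotQZ (dotQC x y1) (dotQC x y2).
have n0 : dotQ y1 y2 != 0 by rewrite lt_eqF.
set a := dotQ y1 y2 in y12 n0 *; set p := dotQ y1 x; set q := dotQ y2 x.
by field.
Qed.

(** Stated for all [d] up to a threshold, so that several such conditions are met at once by the
    least threshold. *)
Lemma perturbation (A B C : R) : A < 0 ->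
  exists2 d0, 0 < d0 & forall d, 0 < d <= d0 -> A + d * B + d ^+ 2 * C < 0.
Proof.
move=> A0; pose W := `|B| + `|C| + 1.
have W0 : 0 < W by rewrite ltr_wpDl// addr_ge0.
pose d0 := Num.min 1 (- A / (2 * W)).
exists d0; first by rewrite lt_min ltr01 divr_gt0 ?oppr_gt0// mulr_gt0.
move=> d /andP[dgt0]; rewrite le_min => /andP[d1].
rewrite ler_pdivlMr ?mulr_gt0// => dA.
have hB : d * B <= d * `|B| by rewrite ler_pM2l// ler_norm.
have hC : d ^+ 2 * C <= d * `|C|.
  apply: (@le_trans _ _ (d ^+ 2 * `|C|)).
    by rewrite ler_wpM2l ?sqr_ge0// ler_norm.
  by rewrite ler_wpM2r// expr2 ler_piMl// ltW.
have : d * (2 * W) = 2 * (d * `|B| + d * `|C| + d) by rewrite /W; ring.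
have : 0 <= d * `|B| by rewrite mulr_ge0// ltW.
have : 0 <= d * `|C| by rewrite mulr_ge0// ltW.
by lra.
Qed.

End Potentials.

(** * Points slightly in the future, and finiteness of lengths *)

Section FutureCone.
Context {R : realType}.
Notation E := 'rV[R]_4.
Notation mu := (@lebesgue_measure R).
Implicit Types (x z e : E) (S : set ('rV[R]_3 * R)) (f : 'rV[R]_3 -> R).

(** The first two conditions say that the tangential part of [z] at [x] is timelike and future
    directed. The third one makes [dotQ_lt1] applicable to the normalisation of [z]. *)
Definition future_cone f x z : Prop :=
  [/\ dotQ x z ^+ 2 + Q z < 0, 0 < om x z &
      forall y, bdD2 y -> dotQ z (boundary_ray f y) < 0].

(** Any vector [e] thereby becomes a combination of two elements of the cone, namely of [z] and
    [z + d *: e]. *)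
Lemma future_cone_open S f x z e : defining_map S f -> future_cone f x z ->
  exists2 d, 0 < d & future_cone f x (z + d *: e).
Proof.
move=> Sf [c1 c2 c3].
have [d1 d10 H1] := perturbation (2 * dotQ x z * dotQ x e + 2 * dotQ z e)
  (dotQ x e ^+ 2 + Q e) c1.
have c2N : - om x z < 0 by rewrite oppr_lt0.
have [d2 d20 H2] := perturbation (- om x e) 0 c2N.
have [y1 y1bd y1max] := dotQ_boundary_max z Sf.
have [y2 y2bd y2max] := dotQ_boundary_max e Sf.
have [d3 d30 H3] := perturbation (dotQ e (boundary_ray f y2)) 0 (c3 _ y1bd).
pose d := Num.min d1 (Num.min d2 d3).
have d0 : 0 < d by rewrite !lt_min d10 d20.
have dd1 : d <= d1 by rewrite ge_min lexx.
have dd2 : d <= d2 by rewrite !ge_min lexx orbT.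
have dd3 : d <= d3 by rewrite !ge_min lexx !orbT.
exists d => //; split.
- have := H1 d; rewrite d0 => /(_ dd1); rewrite dotQD dotQZ QD QZ dotQZ.
  by apply: le_lt_trans; rewrite le_eqVlt; apply/orP; left; apply/eqP; ring.
- by have := H2 d; rewrite d0 => /(_ dd2); rewrite omD omZ; lra.
- move=> y ybd; have := H3 d; rewrite d0 => /(_ dd3).
  rewrite mulr0 addr0; apply: le_lt_trans; rewrite dotQDl dotQZl.
  by rewrite lerD ?y1max// ler_pM2l// y2max.
Qed.

(** [J] is the value at [x] of the rotation field of the (u, v) plane. It is orthogonal to [x],
    timelike and future directed, so a small step from [x] along it enters the cone. *)
Lemma future_cone_nonempty S f x : defining_map S f -> invisible_domain f x ->
  exists z, future_cone f x z.
Proof.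
move=> Sf Mx; have Qx : Q x = - 1 by exact: invisible_domain_AdS Mx.
have xneg y := @invisible_domain_lt0 _ _ _ _ y Sf Mx.
pose J : E := \row_(j < 4) [:: - x 0 1; x 0 0; 0; 0]`_j.
have [y1 y1bd y1max] := dotQ_boundary_max x Sf.
have [y2 y2bd y2max] := dotQ_boundary_max J Sf.
have [d d0 H] := perturbation (dotQ J (boundary_ray f y2)) 0 (xneg _ y1bd).
have r0 : 0 < x 0 0 ^+ 2 + x 0 1 ^+ 2.
  by have := sqr_ge0 (x 0 2); have := sqr_ge0 (x 0 3); move: Qx; rewrite /Q; lra.
have QJ : Q J = - (x 0 0 ^+ 2 + x 0 1 ^+ 2) by rewrite /Q !mxE /=; ring.
have xJ : dotQ x J = 0 by rewrite /dotQ !mxE /=; ring.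
have oJ : om x J = x 0 0 ^+ 2 + x 0 1 ^+ 2 by rewrite /om !mxE /=; ring.
exists (x + d *: J); split.
- rewrite dotQD dotQZ dotQxx Qx xJ QD QZ dotQZ xJ Qx QJ.
  have : 0 < d ^+ 2 * (x 0 0 ^+ 2 + x 0 1 ^+ 2) by rewrite mulr_gt0// exprn_gt0.
  by lra.
- by rewrite omD omZ omxx oJ add0r mulr_gt0.
- move=> y ybd; have := H d; rewrite d0 lexx => /(_ isT).
  rewrite mulr0 addr0; apply: le_lt_trans; rewrite dotQDl dotQZl.
  by rewrite lerD ?y1max// ler_pM2l// y2max.
Qed.

(** The linear potential of [z], normalised by sqrt (- Q z), stays above -1 by [dotQ_lt1] and starts
    below 1 by the first condition of the cone. The first two conclusions serve for convergence, the
    last one for finiteness. *)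
Lemma future_cone_curve S f x z I c b : defining_map S f ->
  future_cone f x z -> past_causal_curve (invisible_domain f) I c ->
  c 0 = x -> I b ->
  [/\ forall t, 0 <= t <= b -> - Num.sqrt (- Q z) <= - dotQ z (c t),
      forall s t, 0 <= s -> s <= t -> t <= b -> - dotQ z (c t) <= - dotQ z (c s)
    & (\int[mu]_(t in `[0%R, b]) (Num.sqrt (- Q (derive1 c t)))%:E <= pi%:E)%E].
Proof.
move=> Sf [c1 c2 c3] cc cx Ib; have [[Iitv I0 Ige0] Mc _ _] := cc.
have Qz : 0 < - Q z by have := sqr_ge0 (dotQ x z); lra.
pose r := Num.sqrt (- Q z); have r0 : 0 < r by rewrite sqrtr_gt0.
have r2 : r ^+ 2 = - Q z by rewrite sqr_sqrtr// ltW.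
have k0 : 0 < r^-1 by rewrite invr_gt0.
have GN1 w : invisible_domain f w -> -1 < - r^-1 * dotQ z w.
  move=> Mw; rewrite mulNr ltrN2 -dotQZl; apply: (@dotQ_lt1 _ f).
  - by rewrite QZ exprVn r2 invrN mulNr mulVf// -oppr_eq0 gt_eqF.
  - exact: invisible_domain_AdS Mw.
  - by move=> y ybd; rewrite dotQZl pmulr_rlt0// c3.
  - by move=> y; exact: invisible_domain_lt0 Sf Mw.
have It t : 0 <= t <= b -> I t by exact: (Iitv _ _ I0 Ib).
have b0 := Ige0 _ Ib.
have Gx : -1 < - r^-1 * dotQ z (c 0) < 1.
  apply/andP; split; first by apply/GN1/Mc.
  rewrite mulNr -mulrN mulrC ltr_pdivrMr// mul1r.
  rewrite (le_lt_trans (ler_norm _))// normrN -[ltRHS]ger0_norm ?ltW//.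
  rewrite -ltr_sqr ?nnegrE//.
  by rewrite !real_normK ?num_real// r2 cx (dotQC z); lra.
have [||||mono len] := @time_potential_curve _ _ _ _ _ _ _ 0 b
    (@invisible_domain_AdS _ f) cc Ib (lexx 0) b0 (time_potential_dotQ z k0).
- by move=> t tb; apply/GN1/Mc/It.
- move=> w _ _; rewrite le_eqVlt; apply/orP; left; apply/eqP.
  rewrite exprMn sqrrN exprVn r2 (dotQC w z); field; lra.
- by have /andP[] := Gx.
- by rewrite cx.
split.
- move=> t tb; have := GN1 _ (Mc _ (It _ tb)).
  rewrite mulNr ltrN2 lerN2 mulrC ltr_pdivrMr// mul1r; exact: ltW.
- move=> s t s0 st tb; have := mono s t s0 st tb.
  by rewrite !mulNr !lerN2 ler_pM2l.
- apply: (le_trans len); rewrite lee_fin gerBl acos_ge0//.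
  by move: Gx => /andP[/ltW-> /ltW->].
Qed.

End FutureCone.

(** * Finiteness of the cosmological time and convergence of causal curves *)

Section Regularity.
Context {R : realType}.
Notation E := 'rV[R]_4.
Notation mu := (@lebesgue_measure R).
Implicit Types (x z e : E) (S : set ('rV[R]_3 * R)) (f : 'rV[R]_3 -> R).
Implicit Types (M : set E) (c : R -> E) (I : set R).

(** The constant curve on the degenerate interval {0} is admissible, the condition on derivatives
    concerning only a null set. *)
Lemma cosmological_time_ge0 M x : M x -> (0 <= cosmological_time M x)%E.
Proof.
move=> Mx; apply: ereal_sup_ubound; exists [set 0], (cst x); split => //; last first.
  by rewrite /curve_length integral_set1.
split.
- split => //; last by move=> t ->.
  by move=> s t -> -> u /andP[u1 u2]; apply/eqP; rewrite eq_le u1 u2.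
- by move=> t _.
- move=> b _; exists 0; split => // K K0 -[s t] _ /=.
  by rewrite subrr normr0 mulr_ge0// ltW.
- have FF : Filter (nbhs (almost_everywhere mu)).
    exact: ae_filter_ringOfSetsType.
  by apply: filterS (ae_neq (0 : R)) => t /eqP.
Qed.

Lemma cosmological_time_le S f x (C : R) : defining_map S f ->
  (forall I c b, past_causal_curve (invisible_domain f) I c -> c 0 = x -> I b ->
    (\int[mu]_(t in `[0%R, b]) (Num.sqrt (- Q (derive1 c t)))%:E <= C%:E)%E) ->
  (cosmological_time (invisible_domain f) x <= C%:E)%E.
Proof.
move=> Sf H; apply: ge_ereal_sup => _ [I [c [cc cx ->]]].
have [pI _ _ _] := cc; apply: integral_parameter_interval_le => //.
by move=> b Ib; exact: (H I c).
Qed.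

Lemma cosmological_time_lty S f x : defining_map S f -> invisible_domain f x ->
  (cosmological_time (invisible_domain f) x < +oo)%E.
Proof.
move=> Sf Mx; have [z xz] := future_cone_nonempty Sf Mx.
apply: (@le_lt_trans _ _ pi%:E); last exact: ltry.
apply: (cosmological_time_le Sf) => I c b cc cx Ib.
by have [] := future_cone_curve Sf xz cc cx Ib.
Qed.

Lemma cvg_coord (F : set_system R) (FF : Filter F) (c : R -> E) (x : E) :
  (forall i, c t 0 i @[t --> F] --> x 0 i) -> c t @[t --> F] --> x.
Proof.
move=> cx; apply/cvgrPdist_lt => e e0.
near=> t; rewrite [ltLHS]/Num.norm/= mx_normrE.
apply/bigmax_ltP; split => // -[j i] _; rewrite !mxE /= ord1.
by move: i; near: t; apply: filter_forall => i; have /cvgrPdist_lt := cx i; exact.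
Unshelve. all: by end_near. Qed.

(** For [z] in the future cone of the starting point, the product with [z] is monotone and bounded
    along [c], hence convergent. Differences of such products give all linear functions, in
    particular the coordinates. *)
Lemma past_causal_curve_cvg S f c : defining_map S f ->
  past_causal_curve (invisible_domain f) `[0, +oo[ c ->
  exists x, c t @[t --> +oo] --> x.
Proof.
move=> Sf cc; have [_ Mc _ _] := cc.
have I0 (t : R) : 0 <= t -> `[0, +oo[%classic t by move=> t0; rewrite /= in_itv/= t0.
have Mc0 := Mc _ (I0 0 (lexx 0)).
have cvz z : future_cone f (c 0) z -> exists l : R, dotQ z (c t) @[t --> +oo] --> l.
  move=> xz; have H b (b0 : 0 <= b) := future_cone_curve Sf xz cc erefl (I0 b b0).
  have [||l cl] := @nonincreasing_cvg_pinfty R (fun t => - dotQ z (c t))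
    (- Num.sqrt (- Q z)).
  - by move=> s t s0 st; have [_ h _] := H t (le_trans s0 st); exact: h.
  - by move=> t t0; have [h _ _] := H t t0; apply: h; rewrite t0 lexx.
  exists (- l); under eq_fun do rewrite -[dotQ _ _]opprK.
  exact: cvgN.
have cve e : exists l : R, dotQ e (c t) @[t --> +oo] --> l.
  have [z xz] := future_cone_nonempty Sf Mc0.
  have [d d0 xz'] := future_cone_open e Sf xz.
  have [l1 h1] := cvz _ xz; have [l2 h2] := cvz _ xz'.
  exists (d^-1 * (l2 - l1)).
  have -> : (fun t => dotQ e (c t)) =
      (fun t => d^-1 * (dotQ (z + d *: e) (c t) - dotQ z (c t))).
    by apply/funext => t; rewrite dotQDl dotQZl addrAC subrr add0r mulKf// gt_eqF.
  by apply: cvgM; [exact: cvg_cst|exact: cvgB].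
have cvi i : exists l : R, c t 0 i @[t --> +oo] --> l.
  (* The sign of the i-th square in [Q], which turns a product with a basis vector into a
     coordinate. *)
  pose sg : R := if (i < 2)%N then -1 else 1.
  have [l cl] := cve (\row_j (sg *+ (j == i))); exists l.
  suff -> : (fun t => c t 0 i) = (fun t => dotQ (\row_j (sg *+ (j == i))) (c t)).
    by [].
  apply/funext => t; rewrite /dotQ /sg !mxE; move: i {sg l cl}.
  by apply: ord4P; rewrite /= ?mulr0n ?mulr1n; ring.
exists (\row_i sval (cid (cvi i))); apply: cvg_coord => i.
by rewrite mxE; exact: svalP (cid (cvi i)).
Qed.

End Regularity.

(** * Decay of the cosmological time along inextendible curves *)

Section PastBoundary.
Context {R : realType}.
Notation E := 'rV[R]_4.
Notation mu := (@lebesgue_measure R).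
Implicit Types (x w : E) (y : 'rV[R]_3) (S : set ('rV[R]_3 * R)).
Implicit Types (f : 'rV[R]_3 -> R) (c : R -> E).

Lemma Q_boundary_ray f y : bdD2 y -> Q (boundary_ray f y) = 0.
Proof.
move=> [sy y2]; rewrite -dotQxx dotQ_ray_rep subrr cos0 /=.
by move: sy; rewrite /sphere /dot3 /= y2; lra.
Qed.

Definition antipodal_potential f y : E -> R :=
  geodesic_potential (boundary_ray f y) (boundary_ray f (- y)).

Definition antipodal_gradient f y : E -> E :=
  geodesic_gradient (boundary_ray f y) (boundary_ray f (- y)).

Lemma antipodal_potential_gtN1 S f y w : defining_map S f -> bdD2 y ->
  invisible_domain f w -> -1 < antipodal_potential f y w.
Proof.
move=> Sf ybd Mw; have [Nybd y12] := dotQ_antipodal Sf ybd.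
rewrite /antipodal_potential /geodesic_potential ltrBrDr addrC subrr.
rewrite mulr_gt0 ?divr_gt0 ?oppr_gt0// nmulr_rgt0 dotQC.
  exact: invisible_domain_lt0 Sf Mw Nybd.
exact: invisible_domain_lt0 Sf Mw ybd.
Qed.

Lemma antipodal_om_neq0 S f y x : defining_map S f -> bdD2 y ->
  invisible_domain f x -> antipodal_potential f y x < 1 ->
  om x (antipodal_gradient f y x) != 0.
Proof.
move=> Sf ybd Mx Gx1; have [Nybd y12] := dotQ_antipodal Sf ybd.
apply: om_neq0; first exact: invisible_domain_AdS Mx.
have Gx : -1 < antipodal_potential f y x < 1.
  by rewrite Gx1 andbT (antipodal_potential_gtN1 Sf).
have := geodesic_potential_bound (Q_boundary_ray f ybd) (Q_boundary_ray f Nybd)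
  y12 Gx.
set k := (4 / _) ^+ 2; have k0 : 0 < k by rewrite exprn_gt0// divr_gt0// oppr_gt0.
move=> H; rewrite -oppr_gt0 -(pmulr_rgt0 _ k0); apply: lt_le_trans H.
rewrite -/(antipodal_potential f y x).
by move: Gx; set g := antipodal_potential f y x => /andP[? ?]; nra.
Qed.

Lemma cosmological_time_antipodal_le S f y x : defining_map S f -> bdD2 y ->
  invisible_domain f x -> antipodal_potential f y x < 1 ->
  0 < om x (antipodal_gradient f y x) ->
  (cosmological_time (invisible_domain f) x <=
   (pi - acos (antipodal_potential f y x))%:E)%E.
Proof.
move=> Sf ybd Mx Gx1 omx; have [Nybd y12] := dotQ_antipodal Sf ybd.
apply: (cosmological_time_le Sf) => I c b cc cx Ib.
have [[Iitv I0 Ige0] Mc _ _] := cc.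
have [|||| _] := @time_potential_curve _ _ _ _ _ _ _ 0 b
    (@invisible_domain_AdS _ f) cc Ib (lexx 0) (Ige0 _ Ib)
    (time_potential_geodesic y12).
- move=> t tb; apply: (antipodal_potential_gtN1 Sf ybd); apply: Mc.
  exact: (Iitv _ _ I0 Ib).
- move=> w _; apply: geodesic_potential_bound => //; exact: Q_boundary_ray.
- by rewrite cx.
- by rewrite cx.
by rewrite cx.
Qed.

(* Along a past directed curve the potential would increase if the gradient
   pointed to the past, hence could not tend to its infimum [-1]. *)
Lemma antipodal_gradient_future S f y c T : defining_map S f -> bdD2 y ->
  past_causal_curve (invisible_domain f) `[0, +oo[ c ->
  antipodal_potential f y (c t) @[t --> +oo] --> (-1 : R) ->
  0 <= T -> (forall t, T <= t -> antipodal_potential f y (c t) < 1) ->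
  0 < om (c T) (antipodal_gradient f y (c T)).
Proof.
move=> Sf ybd cc Gc T0 Glt1; have [_ Mc _ _] := cc.
have [Nybd y12] := dotQ_antipodal Sf ybd.
have I0 (t : R) : 0 <= t -> `[0, +oo[%classic t.
  by move=> t0; rewrite /= in_itv/= t0.
have MT := Mc _ (I0 _ T0).
rewrite lt_neqAle eq_sym (antipodal_om_neq0 Sf ybd MT (Glt1 _ (lexx _))) /=.
rewrite leNgt; apply/negP => omT.
have GT := antipodal_potential_gtN1 Sf ybd MT.
suff : antipodal_potential f y (c T) <= -1 by rewrite leNgt GT.
apply: (cvgr_to_ge Gc); near=> b.
have Tb : T <= b by near: b; exact: nbhs_pinfty_ge (num_real _).
(* The reversed potential has a future directed gradient at time [T], and the bound G < 1 becomes
   its lower bound -1. Its monotonicity gives G(c T) <= G(c b) for all large b, hence G(c T) <= -1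
   in the limit. *)
have [|||| mono _] := @time_potential_curve _ _ _ _ _ _ _ T b
    (@invisible_domain_AdS _ f) cc (I0 _ (le_trans T0 Tb)) T0 Tb
    (time_potentialN (time_potential_geodesic y12)).
- by move=> t /andP[Tt _]; rewrite ltrN2; exact: Glt1.
- move=> w _ Gw.
  have Gw' : -1 < antipodal_potential f y w < 1.
    by move: Gw; rewrite /antipodal_potential => /andP[? ?]; apply/andP; split; lra.
  rewrite sqrrN; apply: le_trans (geodesic_potential_bound _ _ y12 Gw') _.
  + exact: Q_boundary_ray.
  + exact: Q_boundary_ray.
  + by rewrite -[- geodesic_gradient _ _ w]scaleN1r QZ dotQZ; lra.
- by rewrite -ltrN2 opprK.
- move: omT; rewrite -[- geodesic_gradient _ _ _]scaleN1r omZ.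
  by rewrite /antipodal_gradient; lra.
by have := mono T b (lexx _) Tb (lexx _); rewrite lerN2.
Unshelve. all: by end_near. Qed.

Lemma Q_continuous : continuous (fun x : E => Q x).
Proof.
move=> x; have cM i : {for x, continuous (fun w : E => w 0 i * w 0 i)}.
  by apply: continuousM; exact: coordE_continuous.
have -> : (fun w : E => Q w) = (fun w : E => - (w 0 0 * w 0 0) - w 0 1 * w 0 1 +
    w 0 2 * w 0 2 + w 0 3 * w 0 3).
  by apply/funext => w; rewrite /Q -!expr2.
apply: (@continuousD _ _ _ _ _ x _ (cM 3)).
apply: (@continuousD _ _ _ _ _ x _ (cM 2)).
apply: (@continuousB _ _ _ _ _ x _ (cM 1)).
exact: continuousN (cM 0).
Qed.

(** The limit of [c] lies in AdS and in the closure of the domain, and its products with the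
    boundary rays are nonpositive. Were all of them negative, the limit would belong to the
    domain. *)
Lemma inextendible_limit S f c : defining_map S f ->
  past_causal_curve (invisible_domain f) `[0, +oo[ c ->
  inextendible (invisible_domain f) c ->
  exists x y, [/\ c t @[t --> +oo] --> x, bdD2 y & dotQ x (boundary_ray f y) = 0].
Proof.
move=> Sf cc inext; have [x cx] := past_causal_curve_cvg Sf cc; exists x.
have [_ Mc _ _] := cc.
have Mnear : \forall t \near +oo, invisible_domain f (c t).
  near=> t; apply: Mc; rewrite /= in_itv/= andbT.
  by near: t; exact: nbhs_pinfty_ge (num_real _).
have cdot z : dotQ (c t) z @[t --> +oo] --> dotQ x z.
  under eq_fun do rewrite dotQC.
  by rewrite dotQC; apply: continuous_cvg cx; exact: dotQ_continuous.
have Qx : Q x = - 1.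
  have QF : Q (c t) @[t --> +oo] --> Q x.
    by apply: continuous_cvg cx; exact: Q_continuous.
  apply: (cvg_unique _ QF) => //; apply: cvg_near_cst.
  by apply: filterS Mnear => t /invisible_domain_AdS.
have clx : closure (invisible_domain f) x.
  move=> B Bx; have nB : \forall t \near +oo, B (c t) by exact: cx.
  by have [t [Mt Bt]] := filter_ex (filterI Mnear nB); exists (c t).
have le0 y : bdD2 y -> dotQ x (boundary_ray f y) <= 0.
  move=> ybd; apply: (cvgr_to_le (cdot _)); apply: filterS Mnear => t Mt.
  exact/ltW/(invisible_domain_lt0 Sf Mt ybd).
apply: contrapT => nex; apply: inext; exists x => //.
apply: (invisible_domain_closure Sf clx Qx) => y ybd.
rewrite lt_neqAle le0// andbT; apply/eqP => xy0.
by apply: nex; exists y.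
Unshelve. all: by end_near. Qed.

Lemma cosmological_time_cvg0 S f c : defining_map S f ->
  past_causal_curve (invisible_domain f) `[0, +oo[ c ->
  inextendible (invisible_domain f) c ->
  cosmological_time (invisible_domain f) (c t) @[t --> +oo] --> 0%E.
Proof.
move=> Sf cc inext; have [_ Mc _ _] := cc.
have [x [y [cx ybd xy0]]] := inextendible_limit Sf cc inext.
have [Nybd y12] := dotQ_antipodal Sf ybd.
have I0 (t : R) : 0 <= t -> `[0, +oo[%classic t.
  by move=> t0; rewrite /= in_itv/= t0.
have cG : antipodal_potential f y (c t) @[t --> +oo] --> (-1 : R).
  have -> : -1 = 4 / - dotQ (boundary_ray f y) (boundary_ray f (- y)) *
      (dotQ (boundary_ray f y) x * dotQ (boundary_ray f (- y)) x) - 1.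
    by rewrite (dotQC _ x) xy0; ring.
  apply: cvgB; last exact: cvg_cst.
  apply: cvgM; first exact: cvg_cst.
  by apply: cvgM; apply: continuous_cvg cx; exact: dotQ_continuous.
have [T [Treal Glt1]] : \forall t \near +oo, antipodal_potential f y (c t) < 1.
  by apply: (cvgr_lt _ cG); lra.
have future t : 0 <= t -> T < t -> 0 < om (c t) (antipodal_gradient f y (c t)).
  move=> t0 Tt; apply: (antipodal_gradient_future Sf ybd cc cG t0) => s ts.
  by apply: Glt1; exact: lt_le_trans ts.
have cacos : pi - acos (antipodal_potential f y (c t)) @[t --> +oo] --> (0 : R).
  (* Since pi - acos g = acos (- g), the distance to 0 is below [e1] once g < - cos e1; capping [e1]
     at pi keeps it in the range where cosine decreases. *)
  apply/cvgrPdist_lt => e e0; pose e1 := Num.min e pi.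
  have e10 : 0 < e1 by rewrite lt_min e0 pi_gt0.
  have cose1 : -1 < - cos e1.
    by rewrite ltrN2 -cos0 ltr_cos_pi// ge_min lexx orbT.
  near=> t; have t0 : 0 <= t by near: t; exact: nbhs_pinfty_ge (num_real _).
  have G1 := antipodal_potential_gtN1 Sf ybd (Mc _ (I0 _ t0)).
  have G2 : antipodal_potential f y (c t) < - cos e1.
    by near: t; exact: (cvgr_lt _ cG).
  move: G1 G2; set g := antipodal_potential f y (c t) => G1 G2.
  have gb : -1 <= - g <= 1.
    by have := cos_geN1 e1; move=> *; apply/andP; split; lra.
  have [/andP[a0 api] ca] := acos_def gb.
  rewrite sub0r normrN -[g]opprK acosN// opprB addrCA subrr addr0 ger0_norm//.
  apply: (@lt_le_trans _ _ e1); last by rewrite ge_min lexx.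
  rewrite ltNge; apply/negP => e1a.
  by have := ler_cos_pi (ltW e10) e1a api; rewrite ca; lra.
apply: (@squeeze_cvge _ _ _ _ (cst 0%E) _
  (fun t => (pi - acos (antipodal_potential f y (c t)))%:E)).
- near=> t; have t0 : 0 <= t by near: t; exact: nbhs_pinfty_ge (num_real _).
  have Tt : T < t by near: t; exact: nbhs_pinfty_gt.
  have Mt := Mc _ (I0 _ t0).
  rewrite cosmological_time_ge0//=.
  by apply: (cosmological_time_antipodal_le Sf ybd Mt); [exact: Glt1|exact: future].
- exact: cvg_cst.
- by apply: cvg_EFin; [exact: nearW|exact: cacos].
Unshelve. all: by end_near. Qed.

End PastBoundary.

Theorem proposition8p21 (R : realType) (S : set ('rV[R]_3 * R))
    (f : 'rV[R]_3 -> R) :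
  proper_spacelike_surface S -> defining_map S f ->
  regular_cosmological_time (invisible_domain f).
Proof.
move=> _ Sf; split; first by move=> x; exact: cosmological_time_lty Sf.
by move=> c; exact: cosmological_time_cvg0 Sf.
Qed.
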